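(* Let $\mathcal{L}=\sum_{k=1}^M(-\Delta_{x^k})^{\sigma/2}$, where $x=(x^1,\dots,x^M)$, $x^k\in\mathbb{R}^{n_k}$, $n_k\ge1$, $\sum_{k=1}^Mn_k=N$, $1\le M\le N$, and let $\Phi$ be the profile of the fundamental solution for $\partial_t+\mathcal{L}$. Then there is a constant $c>0$ such that $$\int_{\mathbb{S}^{N-1}}|\mathcal{L}\Phi(r\theta)|\,d\theta\le c\,r^{-N-\sigma}\qquad\text{for all } r\ge1,$$ and $$\int_{\mathbb{S}^{N-1}}|\mathcal{L}\Phi(r\theta)-\mathcal{L}\Phi(r\theta-s\varphi)|\,d\theta\le c\,\delta\, r^{-N-\sigma}\qquad\text{whenever } 0<s<\delta\le1,\ \varphi\in\mathbb{S}^{N-1},\ r\ge1.$$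
   Context: Let $N\ge 1$ and $\sigma\in(0,2)$. For $x=(x^1,\dots,x^M)\in\mathbb{R}^{n_1}\times\cdots\times\mathbb{R}^{n_M}=\mathbb{R}^N$, the operator $(-\Delta_{x^k})^{\sigma/2}$ is the fractional Laplacian of order $\sigma$ acting in the variable $x^k\in\mathbb{R}^{n_k}$ only, with Fourier symbol $|\xi^k|^\sigma$. Thus $\mathcal{L}$ is the Fourier multiplier operator $\widehat{\mathcal{L}u}(\xi)=m(\xi)\widehat u(\xi)$ with $m(\xi)=\sum_{k=1}^M|\xi^k|^\sigma$, $\xi=(\xi^1,\dots,\xi^M)$, $\xi^k\in\mathbb{R}^{n_k}$. The fundamental solution $P$ (solution of $\partial_tP+\mathcal{L}P=0$ in $\mathbb{R}^N\times(0,\infty)$, $P(\cdot,0)=\delta_0$) has the form $P(x,t)=t^{-N/\sigma}\Phi(xt^{-1/\sigma})$, where the profile $\Phi\in C^\infty(\mathbb{R}^N)$ is the probability density with $\widehat\Phi(\xi)=\int_{\mathbb{R}^N}e^{ix\cdot\xi}\Phi(x)\,dx=e^{-m(\xi)}$. Here $d\theta$ is surface measure on $\mathbb{S}^{N-1}$ (counting measure if $N=1$). *)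

(* Defs.v *)
From HB Require Import structures.
From mathcomp Require Import all_boot all_order all_algebra.
From mathcomp Require Import complex.
From mathcomp Require Import all_classical all_reals all_analysis.
From mathcomp Require Import measurable_realfun.

Set Implicit Arguments.
Unset Strict Implicit.
Unset Printing Implicit Defensive.

Import Order.TTheory GRing.Theory Num.Theory.
Import numFieldNormedType.Exports.

Local Open Scope classical_set_scope.
Local Open Scope ring_scope.

Section borel_rV.
Context {R : realType} (n : nat).

Let coord (i : 'I_n) (x : 'rV[R]_n) : measurableTypeR R := x ord0 i.

Let rV_set0 : g_sigma_preimage coord set0.
Proof. exact: sigma_algebra0. Qed.

Let rV_setC A : g_sigma_preimage coord A -> g_sigma_preimage coord (~` A).
Proof. exact: sigma_algebraC. Qed.

Let rV_bigcup (F : _^nat) : (forall i, g_sigma_preimage coord (F i)) ->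
  g_sigma_preimage coord (\bigcup_i (F i)).
Proof. exact: sigma_algebra_bigcup. Qed.

(* The product sigma-algebra, generated by the coordinate functions; it is the
   Borel sigma-algebra of R^n. *)
HB.instance Definition _ := @isMeasurable.Build default_measure_display
  'rV[R]_n (g_sigma_preimage coord) rV_set0 rV_setC rV_bigcup.

Lemma measurable_coord (i : 'I_n) :
  measurable_fun setT (fun x : 'rV[R]_n => x ord0 i : measurableTypeR R).
Proof.
move=> _ Y mY; rewrite setTI; apply: sub_sigma_algebra => /=.
rewrite -bigcup_seq/=; exists i => /=; first by rewrite mem_index_enum.
by exists Y => //; rewrite setTI.
Qed.

Lemma measurable_fun_rV d (T : measurableType d) (f : T -> 'rV[R]_n) :
  (forall i, measurable_fun setT (fun x => f x ord0 i : measurableTypeR R)) ->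
  measurable_fun setT f.
Proof.
move=> mf.
suff h : g_sigma_preimage (fun i => coord i \o f) `<=` measurable.
  move=> _ A mA; rewrite setTI; apply: h.
  by rewrite g_sigma_preimage_comp; exists A => //; rewrite setTI.
apply: smallest_sub; first exact: sigma_algebra_measurable.
rewrite -bigcup_seq; apply: bigcup_sub => i _ A [B mB <-].
exact: mf.
Qed.

End borel_rV.


Section lebesgue_rV.
Context {R : realType}.

Definition rV_cons (n : nat) (p : measurableTypeR R * 'rV[R]_n) : 'rV[R]_n.+1 :=
  row_mx (p.1 : R)%:M p.2.

Definition rV_uncons (n : nat) (x : 'rV[R]_n.+1) :
    measurableTypeR R * 'rV[R]_n :=
  (x ord0 ord0, \row_j x ord0 (lift ord0 j)).

Lemma rV_cons0 n (p : measurableTypeR R * 'rV[R]_n) :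
  rV_cons p ord0 ord0 = p.1.
Proof.
rewrite /rV_cons [X in fun_of_matrix _ _ X](_ : _ = lshift n (@ord0 0)).
  by rewrite (@row_mxEl R 1 1 n) mxE eqxx mulr1n.
exact: val_inj.
Qed.

Lemma rV_consS n (p : measurableTypeR R * 'rV[R]_n) (j : 'I_n) :
  rV_cons p ord0 (lift ord0 j) = p.2 ord0 j.
Proof.
rewrite /rV_cons [X in fun_of_matrix _ _ X](_ : _ = @rshift 1 n j).
  by rewrite (@row_mxEr R 1 1 n).
exact: val_inj.
Qed.

Lemma rV_consK n : cancel (@rV_cons n) (@rV_uncons n).
Proof.
move=> [a x]; rewrite /rV_uncons rV_cons0; congr pair.
by apply/rowP => j; rewrite mxE rV_consS.
Qed.

Lemma measurable_rV_cons n : measurable_fun setT (@rV_cons n).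
Proof.
apply: measurable_fun_rV => i.
have [<-|i0] := eqVneq ord0 i.
  by under eq_fun do rewrite rV_cons0; exact: measurable_fst.
have [j -> _] := unlift_some i0.
apply: (eq_measurable_fun
  (fun p : measurableTypeR R * 'rV[R]_n => p.2 ord0 j)).
  by move=> p _; rewrite rV_consS.
by apply: (measurableT_comp (measurable_coord j)); exact: measurable_snd.
Qed.

Lemma measurable_rV_uncons n : measurable_fun setT (@rV_uncons n).
Proof.
apply: measurable_fun_pair; first exact: measurable_coord.
apply: measurable_fun_rV => i; under eq_fun do rewrite mxE.
exact: measurable_coord.
Qed.

Section lebesgue_rVS.
Variables (n : nat) (mu : {sigma_finite_measure set 'rV[R]_n -> \bar R}).

Definition lebesgue_rVS : set 'rV[R]_n.+1 -> \bar R :=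
  pushforward (lebesgue_measure \x mu)%E (@rV_cons n).

Let lebesgue_rVS0 : lebesgue_rVS set0 = 0%E.
Proof. by rewrite /lebesgue_rVS /pushforward preimage_set0 measure0. Qed.

Let lebesgue_rVS_ge0 A : (0 <= lebesgue_rVS A)%E.
Proof. by rewrite /lebesgue_rVS /pushforward; apply: measure_ge0. Qed.

Let lebesgue_rVS_sigma_additive : semi_sigma_additive lebesgue_rVS.
Proof.
move=> F mF tF mUF; rewrite /lebesgue_rVS /pushforward preimage_bigcup.
apply: measure_semi_sigma_additive.
- by move=> i; rewrite -[X in measurable X]setTI; exact: measurable_rV_cons.
- apply/trivIsetP => /= i j _ _ ij; rewrite -preimage_setI.
  by move/trivIsetP : tF => /(_ _ _ _ _ ij) ->//; rewrite preimage_set0.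
- rewrite -preimage_bigcup -[X in measurable X]setTI.
  exact: measurable_rV_cons.
Qed.

HB.instance Definition _ := isMeasure.Build _ _ _ lebesgue_rVS
  lebesgue_rVS0 lebesgue_rVS_ge0 lebesgue_rVS_sigma_additive.

Let lebesgue_rVS_sigma_finite : sigma_finite setT lebesgue_rVS.
Proof.
have /sigma_finiteP[F [UF ndF Foo]] := sigma_finiteT (@lebesgue_measure R).
have /sigma_finiteP[G [UG ndG Goo]] := sigma_finiteT mu.
exists (fun i => @rV_uncons n @^-1` (F i `*` G i)).
  rewrite -preimage_bigcup (_ : \bigcup_i _ = setT) ?preimage_setT//.
  rewrite -setXTT UF UG predeqE => -[x y]; split.
    by move=> [k _ []/= ? ?]; split; exists k.
  move=> [/= [k _ Fkx] [l _ Gly]]; exists (maxn k l) => //; split.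
  - by move: x Fkx; exact/subsetPset/ndF/leq_maxl.
  - by move: y Gly; exact/subsetPset/ndG/leq_maxr.
move=> i; have [mF Fioo] := Foo i; have [mG Gioo] := Goo i; split.
  rewrite -[X in measurable X]setTI; apply: measurable_rV_uncons => //.
  exact: measurableX.
rewrite /lebesgue_rVS /pushforward -comp_preimage.
rewrite (_ : _ \o _ = id) ?preimage_id; last exact/funext/rV_consK.
by rewrite product_measure1E// lte_mul_pinfty// ge0_fin_numE.
Qed.

HB.instance Definition _ := @Measure_isSigmaFinite.Build _ _ _ lebesgue_rVS
  lebesgue_rVS_sigma_finite.

End lebesgue_rVS.

Fixpoint lebesgue_rV (n : nat) : {sigma_finite_measure set 'rV[R]_n -> \bar R} :=
  match n with
  | 0 => @dirac _ 'rV[R]_0 0 R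
  | n'.+1 => lebesgue_rVS (lebesgue_rV n')
  end.

End lebesgue_rV.

Section euclidean.
Context {R : realType}.

Definition dot n (x y : 'rV[R]_n) : R := \sum_i x ord0 i * y ord0 i.

(* The library's norm `|x| on row vectors is the sup norm. *)
Definition enorm n (x : 'rV[R]_n) : R := Num.sqrt (dot x x).

Definition sphere n : set 'rV[R]_n := [set x | enorm x = 1].

Definition normalize n (x : 'rV[R]_n) : 'rV[R]_n := (enorm x)^-1 *: x.

Definition punctured_ball n : set 'rV[R]_n := [set x | 0 < enorm x <= 1].

Lemma measurable_enorm n : measurable_fun setT (@enorm n).
Proof.
have dot_ge0 (x : 'rV[R]_n) : 0 <= dot x x.
  by apply: sumr_ge0 => i _; rewrite -expr2 sqr_ge0.
rewrite (_ : @enorm n = (fun a => a `^ 2^-1) \o (fun x => dot x x)); last first.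
  by apply/funext => x; rewrite /= powR12_sqrt.
apply: measurableT_comp; first exact: measurable_powR.
by apply: measurable_sum => i; apply: measurable_funM; exact: measurable_coord.
Qed.

Lemma measurable_normalize n : measurable_fun setT (@normalize n).
Proof.
apply: measurable_fun_rV => i.
rewrite (_ : (fun x => _) = (fun x : 'rV[R]_n => enorm x `^ (-1) * x ord0 i)).
  apply: measurable_funM; last exact: measurable_coord.
  apply: (measurableT_comp (measurable_powR _)); exact: measurable_enorm.
by apply/funext => x; rewrite mxE powR_inv1// sqrtr_ge0.
Qed.

Lemma measurable_punctured_ball n : measurable (@punctured_ball n).
Proof.
rewrite (_ : @punctured_ball n = @enorm n @^-1` `]0, 1]); last first.
  by apply/seteqP; split=> x /=; rewrite in_itv.
by rewrite -[X in measurable X]setTI; exact: measurable_enorm.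
Qed.

End euclidean.

Arguments sphere {R} n.
Arguments punctured_ball {R} n.

Section sphere_measure.
Context {R : realType} (n : nat).

(* Surface measure on the unit sphere as the cone measure
     A |-> n * vol {rho * theta | theta \in A, 0 < rho <= 1},
   carried by the sphere; for n = 1 it is the counting measure on {-1, 1}. *)
Definition sphere_measure : set 'rV[R]_n -> \bar R :=
  pushforward
    (mscale n%:R%:nng
      (mrestr (@lebesgue_rV R n) (@measurable_punctured_ball R n)))
    (@normalize R n).

Let sphere_measure0 : sphere_measure set0 = 0%E.
Proof. by rewrite /sphere_measure /pushforward preimage_set0 measure0. Qed.

Let sphere_measure_ge0 A : (0 <= sphere_measure A)%E.
Proof. by rewrite /sphere_measure /pushforward; apply: measure_ge0. Qed.

Let sphere_measure_sigma_additive : semi_sigma_additive sphere_measure.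
Proof.
move=> F mF tF mUF; rewrite /sphere_measure /pushforward preimage_bigcup.
apply: measure_semi_sigma_additive.
- by move=> i; rewrite -[X in measurable X]setTI; exact: measurable_normalize.
- apply/trivIsetP => /= i j _ _ ij; rewrite -preimage_setI.
  by move/trivIsetP : tF => /(_ _ _ _ _ ij) ->//; rewrite preimage_set0.
- rewrite -preimage_bigcup -[X in measurable X]setTI.
  exact: measurable_normalize.
Qed.

HB.instance Definition _ := isMeasure.Build _ _ _ sphere_measure
  sphere_measure0 sphere_measure_ge0 sphere_measure_sigma_additive.

End sphere_measure.

Arguments sphere_measure {R} n.

Section fourier.
Context {R : realType} (n : nat).

Definition cexpi (t : R) : R[i] := Complex (cos t) (sin t).

Definition cintegral (f : 'rV[R]_n -> R[i]) : R[i] :=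
  Complex (\int[lebesgue_rV n]_x complex.Re (f x))
          (\int[lebesgue_rV n]_x complex.Im (f x)).

Definition fourier (u : 'rV[R]_n -> R[i]) (xi : 'rV[R]_n) : R[i] :=
  cintegral (fun x => cexpi (dot x xi) * u x).

Definition inv_fourier (g : 'rV[R]_n -> R[i]) (x : 'rV[R]_n) : R[i] :=
  ((2 * pi) ^- n)%:C%C *
    cintegral (fun xi => cexpi (- dot x xi) * g xi).

(* T_m u := F^-1 (m * F u), evaluated pointwise; when m * F u is integrable this
   is the continuous representative. *)
Definition fourier_multiplier (m : 'rV[R]_n -> R) (u : 'rV[R]_n -> R[i]) :
    'rV[R]_n -> R[i] :=
  inv_fourier (fun xi => (m xi)%:C%C * fourier u xi).

End fourier.

Section anisotropic_laplacian.
Context {R : realType} (M : nat) (n : 'I_M -> nat) (sigma : R).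

Local Notation N := (\sum_(k < M) n k)%N.

Definition partial_symbol (k : 'I_M) (xi : 'rV[R]_N) : R :=
  enorm (submxrow xi k) `^ sigma.

Definition symbol (xi : 'rV[R]_N) : R := \sum_(k < M) partial_symbol k xi.

(* (- Laplacian in the k-th block of variables)^(sigma / 2), i.e. the operator
   with Fourier symbol |xi^k|^sigma. *)
Definition partial_frac_laplacian (k : 'I_M) (u : 'rV[R]_N -> R[i]) :
    'rV[R]_N -> R[i] :=
  fourier_multiplier (partial_symbol k) u.

Definition aniso_laplacian (u : 'rV[R]_N -> R[i]) (x : 'rV[R]_N) : R[i] :=
  \sum_(k < M) partial_frac_laplacian k u x.

End anisotropic_laplacian.

Section profile.
Context {R : realType}.

Definition partial_derive n (i : 'I_n) (f : 'rV[R]_n -> R) : 'rV[R]_n -> R :=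
  fun x => 'D_(delta_mx ord0 i) f x.

(* C^infinity: partial derivatives of all orders exist and are continuous. *)
Definition smooth n (f : 'rV[R]_n -> R) : Prop :=
  forall s : seq 'I_n,
    let g := foldr (@partial_derive n) f s in
    continuous g /\ forall x i, derivable g x (delta_mx ord0 i).

(* The profile of the fundamental solution
     P(x, t) = t^(- N / sigma) * Phi(t^(- 1 / sigma) * x)
   of the equation P_t + L P = 0, P(., 0) = delta_0: the smooth probability
   density with Fourier transform exp(- symbol). *)
Record is_profile (M : nat) (n : 'I_M -> nat) (sigma : R)
    (Phi : 'rV[R]_(\sum_(k < M) n k) -> R) : Prop := {
  profile_smooth : smooth Phi ;
  profile_ge0 : forall x, 0 <= Phi x ;
  profile_mass1 : (\int[lebesgue_rV _]_x (Phi x)%:E = 1)%E ;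
  profile_fourier : forall xi,
    fourier (fun x => (Phi x)%:C%C) xi = (expR (- symbol sigma xi))%:C%C }.

End profile.

(* Main.v *)
Require Import Defs.
From HB Require Import structures.
From mathcomp Require Import all_boot all_order all_algebra.
From mathcomp Require Import complex.
From mathcomp Require Import all_classical all_reals all_analysis.
From mathcomp Require Import measurable_realfun ring lra.

(* The function L Phi is the inverse Fourier transform of the sum over l of
     G_l(xi) = |xi^l|^sigma * exp(- m(xi)),
   and each G_l is a product of functions of one block, of the form
   exp(-|xi^k|^sigma) or |xi^k|^sigma * exp(-|xi^k|^sigma). If x . h = pi, then
   replacing G by G - G(. + h) doubles its Fourier transform at x. For each block
   k with |x^k| >= 1 this is iterated 2N + 2 times with
   h = pi x^k / |x^k|^2. The iterated difference of a block factor g is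
   O(|h|^sigma (1 + |xi^k| / |h|)^(-2N)): for |xi^k| >> |h| it is estimated by the
   derivatives of t |-> g(xi + t h), and for |xi^k| <~ |h| by
   g = (polynomial of degree <= 1) + O(|xi^k|^sigma), the differences of the
   polynomial being zero. Integrating in xi gives
     |L Phi(x)| <= C prod_k (1 + |x^k|)^(- n_k - sigma),
   and the same bound for the gradient, since the factors xi_i g have the same
   structure. On the sphere of radius r one block has norm >= r / M and contributes
   r^(- n_k - sigma), and integrating the bound over the remaining N - n_k
   variables contributes r^(- (N - n_k)). *)

Set Implicit Arguments.
Unset Strict Implicit.
Unset Printing Implicit Defensive.

Import Order.TTheory GRing.Theory Num.Theory.
Import numFieldNormedType.Exports.
Import Normc.

Local Open Scope classical_set_scope.
Local Open Scope ring_scope.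

(** * Integration over R^n *)

(** The obstacle is that |xi^k|^sigma is not smooth across xi^k = 0, where repeated integration by
    parts breaks down. Differences of step |h| = pi / |x^k| survive it: a differenced block factor
    has height |h|^sigma and width |h|, so its integral is of order |h|^(n_k + sigma), which is the
    claimed power of |x^k|. The number 2N + 2 has two sources. Decay of order 2N lets each of the at
    most N coordinates of a block receive its own integrable factor (1 + |xi_i| / |h|)^(-2). Two
    more differences are spent on |xi^k|^sigma <= |h|^sigma (|xi^k| / |h|)^2 for |xi^k| >= |h|. All
    majorants become products of functions of a single coordinate, so that only one-dimensional
    integrals are computed. The same device works on the sphere, since surface measure is the image
    of N times Lebesgue measure on the punctured unit ball under y -> y / |y|. *)

Section monotone.
Context d (T : measurableType d) (R : realType).
Variable mu : {measure set T -> \bar R}.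
Local Open Scope ereal_scope.

(* The integral of a nonnegative function is a supremum over the simple
   functions below it, whether or not the function is measurable. *)
Lemma ge0_le_integral_nomeas (D : set T) (f g : T -> \bar R) :
  (forall x, D x -> 0 <= f x) -> (forall x, D x -> f x <= g x) ->
  \int[mu]_(x in D) f x <= \int[mu]_(x in D) g x.
Proof.
move=> f0 fg.
have g0 x : D x -> 0 <= g x by move=> Dx; exact: le_trans (f0 _ Dx) (fg _ Dx).
rewrite !ge0_integralE//; apply: ge_ereal_sup => _ [h hf <-].
apply: ereal_sup_ubound; exists h => // x; apply: le_trans (hf x) _.
by rewrite /patch; case: ifPn => // /set_mem Dx; exact: fg.
Qed.

End monotone.

Section lebesgue_translation.
Context {R : realType}.
Local Open Scope ereal_scope.

(** The image of Lebesgue measure under a translation agrees with it on half-open intervals, which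
    determine the measure. *)
Lemma lebesgue_measure_translate (h : R) (A : set (measurableTypeR R)) :
  measurable A ->
  lebesgue_measure ((fun x : measurableTypeR R => (x + h)%R) @^-1` A)
  = lebesgue_measure A.
Proof.
move=> mA.
have mt : measurable_fun setT (fun x : measurableTypeR R => (x + h)%R :
  measurableTypeR R).
  by apply: measurable_funD => //; exact: measurable_cst.
pose t : {mfun measurableTypeR R >-> measurableTypeR R} := 
   HB.pack (fun x : measurableTypeR R => (x + h)%R : measurableTypeR R)
     (isMeasurableFun.Build _ _ _ _ _ mt).
apply/esym.
rewrite (@lebesgue_measure_unique R (pushforward lebesgue_measure t))//.
move=> X [[a b]/= _ <-].
rewrite /pushforward /=.
have -> : t @^-1` `]a, b]%classic = `](a - h)%R, (b - h)%R]%classic.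
  by apply/seteqP; split => x/=; rewrite !in_itv/= ltrBlDr lerBrDr.
rewrite !lebesgue_measure_itv/= !lte_fin ltrD2r.
by case: ifPn => // _; rewrite -!EFinB; congr EFin; ring.
Qed.

Lemma ge0_integral_translate1 (h : R) (f : R -> \bar R) :
  measurable_fun setT f -> (forall x, 0 <= f x) ->
  \int[lebesgue_measure]_x f (x + h)%R = \int[lebesgue_measure]_x f x.
Proof.
move=> mf f0.
have mt : measurable_fun setT (fun x : measurableTypeR R => (x + h)%R :
  measurableTypeR R).
  by apply: measurable_funD => //; exact: measurable_cst.
have := @ge0_integral_pushforward _ _ _ _ R _ mt lebesgue_measure setT f
  measurableT mf (fun x _ => f0 x).
rewrite preimage_setT => <-.
apply: eq_measure_integral => A mA _.
exact: lebesgue_measure_translate.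
Qed.

End lebesgue_translation.

Section lebesgue_rV_integral.
Context {R : realType}.
Local Open Scope ereal_scope.

Lemma ge0_integral_rV0 (f : 'rV[R]_0 -> \bar R) :
  measurable_fun setT f -> (forall x, 0 <= f x) ->
  \int[lebesgue_rV 0]_x f x = f 0%R.
Proof.
move=> mf f0.
by rewrite /= integral_dirac// diracT mul1e.
Qed.

Lemma ge0_integral_rVS n (f : 'rV[R]_n.+1 -> \bar R) :
  measurable_fun setT f -> (forall x, 0 <= f x) ->
  \int[lebesgue_rV n.+1]_x f x =
  \int[lebesgue_measure]_t \int[lebesgue_rV n]_y f (rV_cons (t, y)).
Proof.
move=> mf f0.
have mfc : measurable_fun setT (f \o @rV_cons R n).
  exact: (measurableT_comp mf (@measurable_rV_cons R n)).
have fc0 x : 0 <= (f \o @rV_cons R n) x by exact: f0.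
rewrite -(@fubini_tonelli1 _ _ (measurableTypeR R) _ R lebesgue_measure
  (lebesgue_rV n) _ mfc fc0).
have := @ge0_integral_pushforward _ _ _ _ R _ (@measurable_rV_cons R n)
  (lebesgue_measure \x lebesgue_rV n) setT f measurableT mf (fun x _ => f0 x).
rewrite preimage_setT => <-.
by apply: eq_measure_integral => [|A mA _]; first exact: measurable_rV_cons.
Qed.

Lemma measurable_translate n (h : 'rV[R]_n) : measurable_fun setT (fun x : 'rV[R]_n
  => (x + h)%R).
Proof.
apply: measurable_fun_rV => i.
under eq_fun do rewrite mxE.
by apply: measurable_funD => //; exact: measurable_coord.
Qed.

Lemma ge0_integral_translate n (h : 'rV[R]_n) (f : 'rV[R]_n -> \bar R) :
  measurable_fun setT f -> (forall x, 0 <= f x) ->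
  \int[lebesgue_rV n]_x f (x + h)%R = \int[lebesgue_rV n]_x f x.
Proof.
elim: n h f => [|n IH] h f mf f0.
  rewrite !ge0_integral_rV0//; first by congr f; apply/rowP; case.
  exact: (measurableT_comp mf (measurable_translate h)).
have mfh := measurableT_comp mf (measurable_translate h).
rewrite (ge0_integral_rVS mf f0) (ge0_integral_rVS mfh (fun x => f0 _)).
have mfc : measurable_fun setT (f \o @rV_cons R n).
  exact: (measurableT_comp mf (@measurable_rV_cons R n)).
have fc0 x : 0 <= (f \o @rV_cons R n) x by exact: f0.
have mF := @measurable_fun_fubini_tonelli_F _ _ (measurableTypeR R) _ R
  (lebesgue_rV n) _ mfc fc0.
have F0 t : 0 <= \int[lebesgue_rV n]_y f (rV_cons (t, y)) by exact: integral_ge0.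
rewrite -(ge0_integral_translate1 (h ord0 ord0) mF F0).
apply: eq_integral => t _.
have mft := measurableT_comp mfc (measurable_pair1 (t + h ord0 ord0)%R).
rewrite -[RHS](IH (\row_j h ord0 (lift ord0 j))%R _ mft (fun x => f0 _)).
apply: eq_integral => y _; congr f.
apply/rowP => i; have [<-|i0] := eqVneq ord0 i.
  by rewrite mxE !rV_cons0.
have [j -> _] := unlift_some i0.
by rewrite mxE !rV_consS/= !mxE.
Qed.

Lemma integrable_translate n (h : 'rV[R]_n) (f : 'rV[R]_n -> R) :
  (lebesgue_rV n).-integrable setT (EFin \o f) ->
  (lebesgue_rV n).-integrable setT (EFin \o (fun x => f (x + h)%R)).
Proof.
move=> /integrableP[mf foo]; apply/integrableP; split.
  exact: (measurableT_comp mf (measurable_translate h)).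
by rewrite (@ge0_integral_translate _ h (fun x => `|(f x)%:E|))//;
  exact: measurableT_comp.
Qed.

Lemma Rintegral_translate n (h : 'rV[R]_n) (f : 'rV[R]_n -> R) :
  (lebesgue_rV n).-integrable setT (EFin \o f) ->
  (\int[lebesgue_rV n]_x f (x + h) = \int[lebesgue_rV n]_x f x)%R.
Proof.
move=> /integrableP[mf foo]; rewrite /Rintegral; congr fine.
rewrite integralE [RHS]integralE; congr (_ - _).
  rewrite -[RHS](ge0_integral_translate h (measurable_funepos mf) (funepos_ge0 _)).
  by apply: eq_integral => x _; rewrite !funeposE.
rewrite -[RHS] (ge0_integral_translate h (measurable_funeneg mf) (funeneg_ge0 _)).
by apply: eq_integral => x _; rewrite !funenegE.
Qed.

(** Both the frequency integrals and the integrals over the ball are estimated through this bound,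
    applied to majorants that split over the coordinates. *)
Lemma ge0_integral_prod_le n (w : 'I_n -> R -> R) (c : 'I_n -> R) :
  (forall i, measurable_fun setT (w i)) -> (forall i t, 0 <= w i t)%R ->
  (forall i, \int[lebesgue_measure]_t (w i t)%:E <= (c i)%:E) ->
  \int[lebesgue_rV n]_x (\prod_i w i (x ord0 i))%:E <= (\prod_i c i)%:E.
Proof.
elim: n w c => [|n IH] w c mw w0 wc.
  rewrite ge0_integral_rV0//= ?big_ord0//; last by move=> x; rewrite big_ord0.
  by under eq_fun do rewrite big_ord0; exact: measurable_cst.
have mprod m (v : 'I_m -> R -> R) :
    (forall i, measurable_fun setT (v i)) ->
    measurable_fun setT (fun x : 'rV[R]_m => \prod_i v i (x ord0 i))%R.
  move=> mv; apply: measurable_prod => i _.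
  exact: (measurableT_comp (mv i) (measurable_coord i)).
have prod0 m (v : 'I_m -> R -> R) (x : 'rV[R]_m) : (forall i t, (0 <= v i t)%R) ->
    0 <= (\prod_i v i (x ord0 i))%:E.
  by move=> v0; rewrite lee_fin prodr_ge0.
have c0 i : (0 <= c i)%R.
  by rewrite -lee_fin; apply: le_trans (wc i); apply: integral_ge0 => t _;
    rewrite lee_fin.
have mp : measurable_fun setT (fun x : 'rV[R]_n.+1 => (\prod_i w i (x ord0 i))%:E).
  by apply/measurable_EFinP; apply: mprod => i; exact: mw.
rewrite (ge0_integral_rVS mp (fun x => prod0 _ _ _ w0)).
apply: (@le_trans _ _ (\int[lebesgue_measure]_t ((w ord0 t)%:E * (\prod_(i < n) c
  (lift ord0 i))%:E))).
  apply: ge0_le_integral_nomeas => t _ /=.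
    by apply: integral_ge0 => y _; rewrite lee_fin; apply: prodr_ge0.
  under eq_integral.
    move=> y _; rewrite big_ord_recl rV_cons0/= EFinM.
    under eq_bigr do rewrite rV_consS/=.
    over.
  rewrite ge0_integralZl//=; last 3 first.
  - by apply/measurable_EFinP; apply: (mprod n (fun i => w (lift ord0 i))) => i;
      exact: mw.
  - by move=> y _; rewrite lee_fin; apply: prodr_ge0.
  - by rewrite lee_fin.
  apply: lee_pmul; rewrite ?lee_fin//; last exact: (IH (fun i => w (lift ord0 i))).
  by apply: integral_ge0 => y _; rewrite lee_fin; apply: prodr_ge0.
rewrite ge0_integralZr//; last 3 first.
- by apply/measurable_EFinP; exact: mw.
- by move=> t _; rewrite lee_fin.
- by rewrite lee_fin prodr_ge0.
by rewrite big_ord_recl EFinM lee_pmul// ?lee_fin ?prodr_ge0//;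
  apply: integral_ge0 => t _; rewrite lee_fin.
Qed.

End lebesgue_rV_integral.

(** * Derivative bounds and finite differences *)

Lemma powR_mono (R : realType) (r x y : R) :
  0 <= r -> 0 <= x -> x <= y -> x `^ r <= y `^ r.
Proof.
by move=> r0 x0 xy; apply: (ge0_ler_powR r0) => //; rewrite nnegrE// (le_trans x0).
Qed.

Lemma powRN_le (R : realType) (p x y : R) : 0 <= p -> 0 < x -> x <= y ->
  y `^ (- p) <= x `^ (- p).
Proof.
move=> p0 x0 xy; have y0 := lt_le_trans x0 xy.
by rewrite !powRN lef_pV2 ?posrE ?powR_gt0//; apply: powR_mono => //; exact: ltW.
Qed.

Lemma powRVN (R : realType) (x p : R) : 0 <= x -> x^-1 `^ p = x `^ (- p).
Proof. by move=> x0; rewrite -powR_inv1// -powRrM mulN1r. Qed.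

Ltac nonneg := repeat first
  [ assumption | apply: exprn_ge0 | exact: powR_ge0 | exact: expR_ge0
  | exact: ltW | exact: ler0n | exact: ler01 | apply: addr_ge0 | apply: mulr_ge0 ].

Section derivative_bounds.
Context {R : realType}.
Implicit Types (I : set R) (f g q : R -> R) (B e : R).

(* [f] has [j] derivatives at the points of [I], the [i]-th one being bounded by
   [B * e ^+ i]. *)
Fixpoint derivs_le (j : nat) I f B e : Prop :=
  (forall t, I t -> `|f t| <= B) /\
  if j is j'.+1 then
    exists2 f', (forall t, I t -> is_derive t 1 f (f' t)) &
                derivs_le j' I f' (B * e) e
  else True.

Lemma derivs_leW j I f B e : derivs_le j.+1 I f B e -> derivs_le j I f B e.
Proof.
elim: j f B => [|j IH] f B /=; first by move=> [? _].
by move=> [fB [f' df /IH ?]]; split => //; exists f'.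
Qed.

Lemma derivs_le_le j I f B B' e : 0 <= e -> B <= B' ->
  derivs_le j I f B e -> derivs_le j I f B' e.
Proof.
move=> e0; elim: j f B B' => [|j IH] f B B' BB' /= [fB H]; split => //.
- by move=> t It; exact: le_trans (fB _ It) BB'.
- by move=> t It; exact: le_trans (fB _ It) BB'.
- by case: H => f' df f'B; exists f' => //; apply: IH f'B; rewrite ler_wpM2r.
Qed.

Lemma derivs_le_cst j I (c : R) e : 0 <= e -> derivs_le j I (fun=> c) `|c| e.
Proof.
move=> e0; elim: j c => [|j IH] c /=; split => //.
exists (fun=> 0) => [t _|]; first exact: is_derive_cst.
have /(derivs_le_le e0) : derivs_le j I (fun=> 0 : R) 0 e by have := IH 0;
  rewrite normr0.
by apply; rewrite mulr_ge0.
Qed.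

Lemma derivs_leD j I f g B B' e :
  derivs_le j I f B e -> derivs_le j I g B' e ->
  derivs_le j I (fun t => f t + g t) (B + B') e.
Proof.
elim: j f g B B' => [|j IH] f g B B' /= [fB Hf] [gB Hg]; split => //.
- by move=> t It; apply: le_trans (ler_normD _ _) _; rewrite lerD ?fB ?gB.
- by move=> t It; apply: le_trans (ler_normD _ _) _; rewrite lerD ?fB ?gB.
- case: Hf => f' df Hf; case: Hg => g' dg Hg.
  exists (fun t => f' t + g' t); last by rewrite mulrDl; exact: IH.
  by move=> t It; have := @is_deriveD _ _ _ f g t 1 _ _ (df _ It) (dg _ It).
Qed.

Lemma derivs_leZ j I (c : R) f B e :
  derivs_le j I f B e -> derivs_le j I (fun t => c * f t) (`|c| * B) e.
Proof.
elim: j f B => [|j IH] f B /= [fB Hf]; split => //.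
- by move=> t It; rewrite normrM ler_wpM2l ?fB.
- by move=> t It; rewrite normrM ler_wpM2l ?fB.
- case: Hf => f' df Hf.
  exists (fun t => c * f' t); last by rewrite -mulrA; exact: IH.
  by move=> t It; have := @is_deriveZ _ _ _ f c t 1 _ (df _ It).
Qed.

(** Each differentiation turns one product into two, whence the factor [2 ^+ j]. *)
Lemma derivs_leM j I f g B B' e : 0 <= e -> 0 <= B -> 0 <= B' ->
  derivs_le j I f B e -> derivs_le j I g B' e ->
  derivs_le j I (fun t => f t * g t) (2 ^+ j * (B * B')) e.
Proof.
move=> e0; elim: j f g B B' => [|j IH] f g B B' B0 B'0.
  move=> /= [fB _] [gB _]; split => // t It.
  by rewrite expr0 mul1r normrM ler_pM ?fB ?gB.
move=> fjB gjB'; have fW := derivs_leW fjB; have gW := derivs_leW gjB'.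
have [fB [f' df Hf]] := fjB; have [gB [g' dg Hg]] := gjB'.
split=> [t It|].
  rewrite normrM; apply: (@le_trans _ _ (B * B')); first by rewrite ler_pM ?fB ?gB.
  by rewrite ler_peMl ?mulr_ge0// exprn_ege1// ler1n.
exists (fun t => f t * g' t + g t * f' t).
  by move=> t It; have := @is_deriveM _ _ f g t 1 _ _ (df _ It) (dg _ It).
rewrite (_ : _ * _ = 2 ^+ j * (B * (B' * e)) + 2 ^+ j * (B' * (B * e)));
  last by rewrite exprS; ring.
by apply: derivs_leD; apply: IH => //; rewrite mulr_ge0.
Qed.

(** Differentiating q^a gives a q^(a-1) q', so the induction on [j] lowers the exponent, possibly
    below 0; hence the lower bound [lo]. The constant is chosen before [I], [q] and [e], which later
    makes it the same for all lines. *)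
Lemma derivs_le_powR (lo Bq : R) : 0 < lo -> 0 <= Bq -> forall j (a : R),
  exists2 C : R, 0 <= C & forall I q e, 0 <= e -> (forall t, I t -> lo <= q t) ->
    derivs_le j I q Bq e -> derivs_le j I (fun t => q t `^ a) C e.
Proof.
move=> lo0 Bq0.
have bnd a : exists2 C : R, 0 <= C & forall x, lo <= x -> x <= Bq -> x `^ a <= C.
  (* One summand covers [0 <= a], the other [a < 0]. *)
  exists (lo `^ a + Bq `^ a); first by rewrite addr_ge0 ?powR_ge0.
  move=> x lox xB; have [a0|a0] := leP 0 a.
    apply: (@le_trans _ _ (Bq `^ a)); last by rewrite lerDr powR_ge0.
    have x0 : 0 <= x by exact: le_trans (ltW lo0) lox.
    exact: powR_mono.
  apply: (@le_trans _ _ (lo `^ a)); last by rewrite lerDl powR_ge0.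
  have x0 : 0 < x by exact: lt_le_trans lox.
  have E y : y `^ a = (y `^ (- a))^-1 by rewrite -powRN opprK.
  rewrite (E x) (E lo) lef_pV2 ?posrE ?powR_gt0//.
  by apply: powR_mono => //; rewrite ?oppr_ge0 ltW.
elim=> [|j IH] a.
  have [C C0 CB] := bnd a; exists C => // I q e e0 loq [qB _]; split => // t It.
  rewrite ger0_norm ?powR_ge0// CB// ?loq//.
  by apply: le_trans (ler_norm _) (qB _ It).
have [C C0 CB] := bnd a; have [D D0 DB] := IH (a - 1).
exists (C + `|a| * (2 ^+ j * (D * Bq))).
  by rewrite addr_ge0// !mulr_ge0// exprn_ge0.
move=> I q e e0 loq qjB; have qW := derivs_leW qjB.
have [qB [q' dq Hq]] := qjB; split=> [t It|].
  rewrite ger0_norm ?powR_ge0//; apply: (@le_trans _ _ C).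
    by rewrite CB// ?loq//; apply: le_trans (ler_norm _) (qB _ It).
  by rewrite lerDl !mulr_ge0// exprn_ge0.
exists (fun t => a * (q t `^ (a - 1) * q' t)).
  move=> t It; have q0 := lt_le_trans lo0 (loq _ It).
  have d := @is_derive1_comp _ (fun x : R => x `^ a) q t _ _ (is_derive1_powR a q0)
    (dq _ It).
  by apply: (is_derive_eq d); rewrite mulrA.
apply: (@derivs_le_le _ _ _ (`|a| * (2 ^+ j * (D * (Bq * e))))) => //.
  rewrite mulrDl (_ : _ * _ * e = `|a| * (2 ^+ j * (D * (Bq * e)))); last by ring.
  by rewrite lerDr mulr_ge0.
apply/derivs_leZ/derivs_leM => //; first by rewrite mulr_ge0.
exact: DB.
Qed.

(** The family indexed by [i] is closed under differentiation up to the factor p', each derivative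
    raising [i] by one; the exponential absorbs the powers of [l] through [D]. The constant does not
    depend on [l] or on the weight [w], which will be 1 + |xi^k| or 1. *)
Lemma derivs_le_expR (c Bp : R) (D : nat -> R) : 0 <= Bp -> (forall i, 0 <= D i) ->
  forall j i, exists2 C : R, 0 <= C & forall I e p (l w : R),
    0 <= e -> 0 <= l -> 0 <= w -> 
    (forall i, l ^+ i * w * expR (- (l * c)) <= D i) ->
    (forall t, I t -> c <= p t) ->
    derivs_le j I p Bp e ->
    derivs_le j I (fun t => l ^+ i * w * expR (- (l * p t))) C e.
Proof.
move=> Bp0 D0.
have bnd i I (p : R -> R) (l w : R) :
    0 <= l -> 0 <= w -> (forall i, l ^+ i * w * expR (- (l * c)) <= D i) ->
    (forall t, I t -> c <= p t) -> forall t, I t ->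
    `|l ^+ i * w * expR (- (l * p t))| <= D i.
  move=> l0 w0 lwD cp t It; rewrite ger0_norm ?mulr_ge0 ?exprn_ge0 ?expR_ge0//.
  apply: le_trans (lwD i); rewrite ler_wpM2l ?mulr_ge0 ?exprn_ge0//.
  by rewrite ler_expR lerN2 ler_wpM2l// cp.
elim=> [|j IH] i.
  by exists (D i) => // I e p l w e0 l0 w0 lwD cp _; split => //; exact: bnd.
have [C C0 CB] := IH i.+1.
exists (D i + 2 ^+ j * (C * Bp)); first by rewrite addr_ge0// !mulr_ge0// exprn_ge0.
move=> I e p l w e0 l0 w0 lwD cp pjB; have pW := derivs_leW pjB.
have [pB [p' dp Hp]] := pjB; split=> [t It|].
  apply: (@le_trans _ _ (D i)); first exact: (bnd i I).
  by rewrite lerDl !mulr_ge0// exprn_ge0.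
exists (fun t => (-1) * ((l ^+ i.+1 * w * expR (- (l * p t))) * p' t)).
  move=> t It.
  have d1 : is_derive t 1 (fun t => - l * p t) (- l * p' t).
    exact: (@is_deriveZ _ _ _ p (- l) t 1 _ (dp _ It)).
  have d2 := @is_derive1_comp _ expR (fun t => - l * p t) t _ _ (is_derive_expR _) d1.
  have d3 := @is_deriveZ _ _ _ _ (l ^+ i * w) t 1 _ d2.
  rewrite (_ : (fun t => _) = (l ^+ i * w) *: (expR \o (fun t => - l * p t)));
    last first.
    by apply/funext => u /=; rewrite -[RHS]/(_ * _) /= mulNr.
  apply: is_derive_eq d3 _; rewrite -[LHS]/(_ * _) (mulNr l (p t)) exprS; ring.
apply: (@derivs_le_le _ _ _ (`|-1| * (2 ^+ j * (C * (Bp * e))))) => //.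
  rewrite normrN1 mul1r mulrDl (_ : 2 ^+ j * (C * Bp) * e = 2 ^+ j * (C * (Bp *
    e))); last by ring.
  by rewrite lerDr mulr_ge0.
apply/derivs_leZ/derivs_leM => //; first by rewrite mulr_ge0.
exact: CB.
Qed.

End derivative_bounds.

Section finite_difference.
Context {R : realType}.

(** With this sign the two terms add up, instead of cancelling, when [h] shifts the cosine by half a
    period. *)
Definition fdiff (V : zmodType) (h : V) (g : V -> R) (x : V) : R :=
  g x - g (x + h).

Lemma iter_fdiff_line (V : lmodType R) (x h : V) (g : V -> R) j (t : R) :
  iter j (fdiff h) g (x + t *: h) = iter j (fdiff 1) (fun t => g (x + t *: h)) t.
Proof.
elim: j t => //= j IH t.
by rewrite /fdiff -/(fdiff _) -!IH scalerDl scale1r addrA.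
Qed.

Lemma iter_fdiffD (V : zmodType) (h : V) (f g : V -> R) j x :
  iter j (fdiff h) (fun x => f x + g x) x = iter j (fdiff h) f x + iter j (fdiff h) g x.
Proof. by elim: j x => //= j IH x; rewrite /fdiff !IH; ring. Qed.

(** A plain triangle inequality, meant for the region near the origin, where no derivatives are
    available. *)
Lemma iter_fdiff_bound (V : zmodType) (h : V) (g : V -> R) (B : R) j x :
  (forall i, (i <= j)%N -> `|g (x + h *+ i)| <= B) ->
  `|iter j (fdiff h) g x| <= 2 ^+ j * B.
Proof.
elim: j x => [|j IH] x gB /=.
  by rewrite expr0 mul1r; have := gB 0 (leqnn _); rewrite mulr0n addr0.
apply: le_trans (ler_normB _ _) _.
rewrite exprS -mulrA mulrDl mul1r lerD//; apply: IH => i ij.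
  by apply: gB; exact: leqW.
by have := gB i.+1 ij; rewrite mulrS addrA.
Qed.

Lemma is_derive_iter_fdiff (f f' : R -> R) j (u : R) :
  (forall t, u <= t <= u + j%:R -> is_derive t 1 f (f' t)) ->
  is_derive u 1 (iter j (fdiff 1) f) (iter j (fdiff 1) f' u).
Proof.
elim: j u => [|j IH] u df /=; first by apply: df; rewrite addr0 lexx.
have d1 : is_derive u 1 (iter j (fdiff 1) f) (iter j (fdiff 1) f' u).
  apply: IH => t /andP[ut tu]; apply: df; rewrite ut (le_trans tu)//.
  by rewrite lerD2l ler_nat.
have d2 : is_derive (u + 1) 1 (iter j (fdiff 1) f) (iter j (fdiff 1) f' (u + 1)).
  apply: IH => t /andP[ut tu]; apply: df.
  by rewrite -natr1; apply/andP; split; lra.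
have d3 := @is_derive1_comp _ _ (shift 1) u _ _ d2 (is_derive_shift _ _ _).
rewrite mulr1 in d3.
exact: (@is_deriveB _ _ _ _ _ u 1 _ _ d1 d3).
Qed.

(** The mean value theorem removes one difference at the price of one derivative: the derivative of
    [iter j (fdiff 1) f] is the iterated difference of f', to which the induction hypothesis applies
    at the intermediate point. *)
Lemma derivs_le_fdiff (I : set R) j (f : R -> R) (B e u : R) :
  derivs_le j I f B e -> (forall t, u <= t <= u + j%:R -> I t) ->
  `|iter j (fdiff 1) f u| <= B * e ^+ j.
Proof.
elim: j f B u => [|j IH] f B u.
  by move=> [fB _] uI /=; rewrite expr0 mulr1; apply/fB/uI; rewrite addr0 lexx.
move=> [fB [f' df Hf]] uI.
have u1 : u <= u + 1 by rewrite lerDl.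
have dD t : u <= t <= u + 1 ->
    is_derive t 1 (iter j (fdiff 1) f) (iter j (fdiff 1) f' t).
  move=> /andP[ut tu]; apply: is_derive_iter_fdiff => s /andP[ts st].
  by apply: df; apply: uI; rewrite -natr1; apply/andP; split; lra.
have cD : {within `[u, u + 1], continuous (iter j (fdiff 1) f)}.
  apply: derivable_within_continuous => t; rewrite in_itv/= => tu.
  by have [] := dD _ tu.
have [t] := MVT_segment u1 (fun t (ht : t \in `]u, u + 1[) =>
  dD t (subset_itv_oo_cc ht)) cD.
rewrite in_itv/= => /andP[ut tu] E.
have -> : fdiff 1 (iter j (fdiff 1) f) u =
    - (iter j (fdiff 1) f (u + 1) - iter j (fdiff 1) f u).
  by rewrite opprB.
rewrite normrN E addrAC subrr add0r mulr1 exprS mulrA.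
apply: IH Hf _ => s /andP[ts st]; apply: uI.
by rewrite -natr1; apply/andP; split; lra.
Qed.

End finite_difference.

(** * Exponential bounds, and norms and coordinates along a line *)

Section stable_profile_on_lines.
Context {R : realType}.
Variable sigma : R.
Hypothesis sigma02 : 0 < sigma < 2.

Let sigma0 : 0 < sigma. Proof. by case/andP: sigma02. Qed.
Let sigma2 : sigma < 2. Proof. by case/andP: sigma02. Qed.

Lemma powR_le_sqr (a : R) : 0 <= a -> a `^ sigma <= (1 + a) ^+ 2.
Proof.
move=> a0; apply: (@le_trans _ _ ((1 + a) `^ sigma)).
  by apply: powR_mono; [exact: ltW | | rewrite lerDr].
by rewrite -powR_mulrn ?addr_ge0// ler_powR ?lerDl// ltW.
Qed.

(** Write exp(c y) as the n-th power of exp(c y / n) and use exp u >= u. *)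
Lemma exprn_expRN_bound (n : nat) (c : R) : 0 < c ->
  forall y, 0 <= y -> y ^+ n * expR (- (c * y)) <= (n%:R / c) ^+ n.
Proof.
move=> c0 y y0; case: n => [|n].
  by rewrite !expr0 mul1r -expR0 ler_expR oppr_le0 mulr_ge0// ltW.
rewrite expRN ler_pdivrMr ?expR_gt0//.
have -> : expR (c * y) = expR (c * y / n.+1%:R) ^+ n.+1.
  by rewrite -expRM_natl (mulrC n.+1%:R) divfK ?pnatr_eq0.
rewrite -exprMn lerXn2r ?nnegrE ?mulr_ge0 ?invr_ge0 ?expR_ge0//; first exact: ltW.
apply: (@le_trans _ _ (n.+1%:R / c * (c * y / n.+1%:R))).
  rewrite [leRHS](_ : _ = y)//; field.
  by rewrite nat1r pnatr_eq0 (gt_eqF c0).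
rewrite ler_wpM2l ?divr_ge0 ?(ltW c0)//.
by apply: le_trans (expR_ge1Dx _); rewrite lerDr.
Qed.

Lemma poly_stretched_exp_bound (L : nat) (c : R) : 0 < c ->
  exists2 D : R, 0 <= D &
    forall a, 0 <= a -> (1 + a) ^+ L * expR (- (c * a `^ sigma)) <= D.
Proof.
move=> c0.
(* Large enough for sigma n >= L, so that a^L <= (a^sigma)^n once a >= 1. *)
pose n := (Num.truncn (L%:R / sigma)).+1.
have nL : L%:R <= sigma * n%:R.
  rewrite mulrC -ler_pdivrMr// ltW// truncnS_gt//.
exists (2 ^+ L + 2 ^+ L * (n%:R / c) ^+ n).
  by rewrite addr_ge0// ?mulr_ge0// exprn_ge0// divr_ge0// ltW.
move=> a a0; have [a1|a1] := leP a 1.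
  apply: (@le_trans _ _ (2 ^+ L * 1)); last first.
    by rewrite mulr1 lerDl mulr_ge0// exprn_ge0// divr_ge0// ltW.
  rewrite ler_pM ?exprn_ge0 ?addr_ge0 ?expR_ge0//.
    by rewrite lerXn2r ?nnegrE ?addr_ge0//; lra.
  by rewrite -expR0 ler_expR oppr_le0 mulr_ge0 ?powR_ge0// ltW.
apply: (@le_trans _ _ (2 ^+ L * (n%:R / c) ^+ n)); last first.
  by rewrite lerDr exprn_ge0.
apply: le_trans (ler_wpM2l _ (exprn_expRN_bound n c0 (powR_ge0 a sigma))); last first.
  by rewrite exprn_ge0.
rewrite mulrA ler_wpM2r ?expR_ge0//.
apply: (@le_trans _ _ ((2 * a) ^+ L)).
  by rewrite lerXn2r ?nnegrE ?addr_ge0 ?mulr_ge0//; lra.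
rewrite exprMn ler_wpM2l ?exprn_ge0// -[leRHS]powR_mulrn ?powR_ge0// -powRrM.
by rewrite -powR_mulrn// ler_powR// ltW.
Qed.

Lemma is_derive_quadratic (c0 c1 c2 t : R) :
  is_derive t 1 (fun t => c0 + c1 * t + c2 * t ^+ 2) (c1 + 2 * c2 * t).
Proof.
have d1 := @is_deriveZ _ _ _ id c1 t 1 _ (is_derive_id t 1).
have d2 := @is_deriveM _ _ id id t 1 _ _ (is_derive_id t 1) (is_derive_id t 1).
have d3 := @is_deriveZ _ _ _ _ c2 t 1 _ d2.
have d4 := @is_deriveD _ _ _ _ _ t 1 _ _ (is_derive_cst c0 t 1) d1.
have d5 := @is_deriveD _ _ _ _ _ t 1 _ _ d4 d3.
by apply: (is_derive_eq d5); rewrite /GRing.scale/=; ring.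
Qed.

(* On the line [t |-> xi + t h], with [a = |xi|], [ep = |h| / |xi|] and [be] the
   cosine of the angle between [xi] and [h], [|xi + t h| ^+ 2 = a ^+ 2 * line_sqr be ep t]. *)
Definition line_sqr (be ep t : R) : R := 1 + 2 * be * ep * t + ep ^+ 2 * t ^+ 2.

(** The condition [2 * K%:R * ep <= 1] keeps the segment from xi to xi + K h at distance at least
    |xi| / 2 from the origin, the singular point of the profile; 1/4 is the square of 1/2. *)
Lemma line_sqr_ge (K : nat) (be ep t : R) : 0 <= ep -> 2 * K%:R * ep <= 1 ->
  `|be| <= 1 -> 0 <= t <= K%:R -> 4^-1 <= line_sqr be ep t.
Proof.
move=> ep0 Kep; rewrite ler_norml => /andP[be1 be2] /andP[t0 tK].
have h1 : 0 <= ep * t by exact: mulr_ge0.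
have h2 : ep * t <= 2^-1.
  apply: (@le_trans _ _ (ep * K%:R)); first by rewrite ler_wpM2l.
  lra.
rewrite /line_sqr; set x := ep * t in h1 h2 *.
rewrite (_ : _ + _ = 1 + 2 * be * x + x ^+ 2); last by rewrite /x; ring.
(* The worst case is be = -1, where [line_sqr] equals (1 - x)^2. *)
have : 4^-1 <= (1 - x) ^+ 2.
  rewrite (_ : 4^-1 = 2^-1 ^+ 2); last by field.
  by rewrite lerXn2r ?nnegrE//; lra.
nra.
Qed.

(** A quadratic polynomial in [ep * t], with [ep * t] at most 1/2: its value is at most 9/4, its
    derivatives at most 3 ep and 2 ep^2, then 0. The constant 4 serves for all of them. *)
Lemma derivs_le_line_sqr (K j : nat) (be ep : R) : 0 <= ep -> 2 * K%:R * ep <= 1 ->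
  `|be| <= 1 -> derivs_le j [set t | 0 <= t <= K%:R] (line_sqr be ep) 4 ep.
Proof.
move=> ep0 Kep be1.
have nbe (t : R) : 0 <= t <= K%:R -> `|be * (ep * t)| <= 2^-1 /\ 0 <= ep * t <= 2^-1.
  move=> /andP[t0 tK].
  have h1 : 0 <= ep * t by exact: mulr_ge0.
  have h2 : ep * t <= 2^-1.
    apply: (@le_trans _ _ (ep * K%:R)); first by rewrite ler_wpM2l.
    lra.
  split; last by rewrite h1.
  by rewrite normrM (ger0_norm h1); apply: le_trans h2; rewrite ler_piMl.
have b0 (t : R) : 0 <= t <= K%:R -> `|line_sqr be ep t| <= 4.
  move=> /nbe[]; rewrite ler_norml => /andP[h1 h2] /andP[h3 h4].
  rewrite /line_sqr (_ : _ + _ = 1 + 2 * (be * (ep * t)) + (ep * t) * (ep * t));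
    last by ring.
  rewrite ler_norml; apply/andP; split; nra.
have d0 (t : R) : is_derive t 1 (line_sqr be ep) (2 * be * ep + 2 * ep ^+ 2 * t).
  exact: is_derive_quadratic.
have b1 (t : R) : 0 <= t <= K%:R -> `|2 * be * ep + 2 * ep ^+ 2 * t| <= 4 * ep.
  move=> /nbe[_ /andP[h3 h4]].
  rewrite (_ : _ + _ = (2 * (be + ep * t)) * ep); last by ring.
  rewrite normrM (ger0_norm ep0) ler_wpM2r// normrM (ger0_norm (ler0n _ 2)).
  have : `|be + ep * t| <= 1 + 2^-1 by apply: le_trans (ler_normD _ _) _;
    rewrite lerD// ger0_norm.
  lra.
have d1 (t : R) : is_derive t 1 (fun t => 2 * be * ep + 2 * ep ^+ 2 * t) (2 * ep ^+ 2).
  have := is_derive_quadratic (2 * be * ep) (2 * ep ^+ 2) 0 t.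
  rewrite (_ : (fun _ => _) = (fun t => 2 * be * ep + 2 * ep ^+ 2 * t)).
    by move=> d; apply: (is_derive_eq d); ring.
  by apply/funext => u; ring.
case: j => [|[|j]]; first by split.
- by split => //; exists (fun t => 2 * be * ep + 2 * ep ^+ 2 * t).
split => //; exists (fun t => 2 * be * ep + 2 * ep ^+ 2 * t) => //.
split => //; exists (fun=> 2 * ep ^+ 2) => //.
apply: derivs_le_le (derivs_le_cst _ _ _ ep0) => //.
rewrite ger0_norm ?mulr_ge0 ?exprn_ge0// -mulrA -expr2 ler_wpM2r ?exprn_ge0//.
by rewrite ler_nat.
Qed.

(** The coordinate xi_i + t h_i on the line of [line_sqr], where ga0 = xi_i / |xi| and ga1 = h_i /
    |h|. *)
Definition line_aff (a ga0 ga1 ep t : R) : R := a * (ga0 + ep * ga1 * t).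

Lemma derivs_le_line_aff (K j : nat) (a ga0 ga1 ep : R) : 0 <= a -> 0 <= ep ->
  2 * K%:R * ep <= 1 -> `|ga0| <= 1 -> `|ga1| <= 1 ->
  derivs_le j [set t | 0 <= t <= K%:R] (line_aff a ga0 ga1 ep) (2 * a) ep.
Proof.
move=> a0 ep0 Kep g0 g1.
have b0 (t : R) : 0 <= t <= K%:R -> `|line_aff a ga0 ga1 ep t| <= 2 * a.
  move=> /andP[t0 tK].
  have h1 : 0 <= ep * t by exact: mulr_ge0.
  have h2 : ep * t <= 2^-1.
    apply: (@le_trans _ _ (ep * K%:R)); first by rewrite ler_wpM2l.
    lra.
  rewrite /line_aff normrM (ger0_norm a0) mulrC ler_wpM2r//.
  apply: le_trans (ler_normD _ _) _.
  rewrite (_ : ep * ga1 * t = ga1 * (ep * t)) 1?(normrM ga1) ?(ger0_norm h1);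
    last by ring.
  have : `|ga1| * (ep * t) <= 1 * (ep * t) by rewrite ler_wpM2r.
  lra.
have d0 (t : R) : is_derive t 1 (line_aff a ga0 ga1 ep) (a * ep * ga1).
  have := is_derive_quadratic (a * ga0) (a * ep * ga1) 0 t.
  rewrite (_ : (fun _ => _) = line_aff a ga0 ga1 ep).
    by move=> d; apply: (is_derive_eq d); ring.
  by apply/funext => u; rewrite /line_aff; ring.
case: j => [|j]; first by split.
split => //; exists (fun=> a * ep * ga1) => //.
apply: derivs_le_le (derivs_le_cst _ _ _ ep0) => //.
rewrite !normrM (ger0_norm a0) (ger0_norm ep0).
have : a * ep * `|ga1| <= a * ep * 1 by rewrite ler_wpM2l// mulr_ge0.
have : 0 <= a * ep by exact: mulr_ge0.
lra.
Qed.

Lemma fdiff_line_aff K (a ga0 ga1 ep t : R) :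
  iter K.+2 (fdiff 1) (line_aff a ga0 ga1 ep) t = 0.
Proof.
rewrite 2!iterSr (_ : fdiff 1 (fdiff 1 _) = fun=> 0); last first.
  by apply/funext => u; rewrite /fdiff /line_aff; ring.
by elim: K t => //= K IH t; rewrite /fdiff !IH subrr.
Qed.

End stable_profile_on_lines.

Section stable_profile_differences.
Context {R : realType}.
Variable sigma : R.
Hypothesis sigma02 : 0 < sigma < 2.

Let sigma0 : 0 < sigma. Proof. by case/andP: sigma02. Qed.

(** A block factor on the same line: [bp] switches on the coordinate factor coming from a gradient,
    [bq] the factor |xi|^sigma coming from the symbol. *)
Definition line_profile (bp bq : bool) (a be ga0 ga1 ep t : R) : R :=
  (if bp then line_aff a ga0 ga1 ep t else 1) *
  (if bq then a `^ sigma * line_sqr be ep t `^ (sigma / 2) else 1) *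
  expR (- (a `^ sigma * line_sqr be ep t `^ (sigma / 2))).

(** The factor a^sigma is the point. It is explicit when [bq] is true, and at least 1 when a >= 1.
    When [bq] is false and a < 1, the exponential is replaced by exp - 1, whose derivatives are
    O(a^sigma); this changes the profile by an affine function, which the differences annihilate. *)
Lemma fdiff_line_profile (K : nat) :
  exists2 C : R, 0 <= C & forall bp bq (a be ga0 ga1 ep : R),
    0 < a -> 0 <= ep -> 2 * K.+2%:R * ep <= 1 ->
    `|be| <= 1 -> `|ga0| <= 1 -> `|ga1| <= 1 ->
    `|iter K.+2 (fdiff 1) (line_profile bp bq a be ga0 ga1 ep) 0| <=
      C * (a `^ sigma * ep ^+ K.+2).
Proof.
have [Cp Cp0 HCp] : exists2 C : R, 0 <= C & forall I q e, 0 <= e ->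
    (forall t, I t -> 4^-1 <= q t) -> derivs_le K.+2 I q 4 e ->
    derivs_le K.+2 I (fun t => q t `^ (sigma / 2)) C e.
  by apply: derivs_le_powR; rewrite ?invr_gt0.
pose c : R := 4^-1 `^ (sigma / 2).
have c0 : 0 < c by rewrite powR_gt0// invr_gt0.
(* Since a^sigma <= (1 + a)^2, decay against the power 2i + 1 of 1 + a is enough. *)
have /choice[D HD] : forall i : nat, exists D : R, 0 <= D /\
    forall a, 0 <= a -> (a `^ sigma) ^+ i * (1 + a) * expR (- (a `^ sigma * c)) <= D.
  move=> i; have [D D0 HD] := poly_stretched_exp_bound sigma02 (2 * i).+1 c0.
  exists D; split => // a a0; apply: le_trans (HD a a0).
  rewrite (mulrC c) ler_wpM2r ?expR_ge0// exprSr exprM ler_wpM2r ?addr_ge0//.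
  by rewrite lerXn2r ?nnegrE ?powR_ge0 ?exprn_ge0 ?addr_ge0// powR_le_sqr.
have D0 i : 0 <= D i by case: (HD i).
have [C1 C10 HC1] := derivs_le_expR c Cp0 D0 K.+2 0.
have [C2 C20 HC2] := derivs_le_expR c Cp0 D0 K.+1 0.
(* [C3] is for [bq] true, [C4] for [bq] false and 1 <= a, [C5] for [bq] false and a < 1. The powers
   of 2 come from [derivs_leM]; the 4 in [C5] bounds 2 (1 + a). *)
pose C3 := 2 ^+ K.+2 * (2 * (2 ^+ K.+2 * (Cp * C1))).
pose C4 := 2 ^+ K.+2 * (2 * C1).
pose C5 := 2 ^+ K.+2 * (4 * (Cp + 2 ^+ K.+1 * (C2 * Cp))).
have C30 : 0 <= C3 by rewrite /C3; nonneg.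
have C40 : 0 <= C4 by rewrite /C4; nonneg.
have C50 : 0 <= C5 by rewrite /C5; nonneg.
exists (C3 + C4 + C5); first by rewrite !addr_ge0.
move=> bp bq a be ga0 ga1 ep a0 ep0 Kep be1 g01 g11.
pose I := [set t : R | 0 <= t <= K.+2%:R].
set l := a `^ sigma.
have l0 : 0 <= l by exact: powR_ge0.
pose p t := line_sqr be ep t `^ (sigma / 2).
have Hp : derivs_le K.+2 I p Cp ep.
  apply: HCp => //; last exact: derivs_le_line_sqr.
  by move=> t It; apply: (line_sqr_ge (K := K.+2)).
have cp t : I t -> c <= p t.
  move=> It; apply: powR_mono; rewrite ?invr_ge0//; first by rewrite divr_ge0// ltW.
  exact: (line_sqr_ge (K := K.+2)).
have a10 : 0 < 1 + a by rewrite addr_gt0.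
(* The affine factor has size 1 + a. It is divided by 1 + a, and the exponential carries this weight
   in exchange. *)
pose E1 t := l ^+ 0 * (1 + a) * expR (- (l * p t)).
have HE1 : derivs_le K.+2 I E1 C1 ep.
  apply: HC1 => //; first exact: ltW.
  by move=> i; case: (HD i) => _; apply; exact: ltW.
have HE : derivs_le K.+1 I (fun t => l ^+ 0 * 1 * expR (- (l * p t))) C2 ep.
  apply: HC2 => //; last exact: derivs_leW.
  move=> i; case: (HD i) => _ /(_ _ (ltW a0)); apply: le_trans.
  by rewrite ler_wpM2r ?expR_ge0// ler_wpM2l ?exprn_ge0// lerDl ltW.
pose P t := if bp then line_aff a ga0 ga1 ep t else 1.
have HP : derivs_le K.+2 I P (2 * (1 + a)) ep.
  rewrite /P; case: (bp) => /=.
    apply: (derivs_le_le ep0 _ (derivs_le_line_aff K.+2 (ltW a0) ep0 Kep g01 g11)).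
    by rewrite mulrDr lerDr.
  apply: (derivs_le_le ep0 _ (derivs_le_cst K.+2 I 1 ep0)).
  rewrite normr1; have := ltW a0; lra.
have HP2 : derivs_le K.+2 I (fun t => (1 + a)^-1 * P t) 2 ep.
  have := derivs_leZ (1 + a)^-1 HP.
  by rewrite ger0_norm ?invr_ge0 ?(ltW a10)// mulrC mulfK// gt_eqF.
have IT t : 0 <= t <= 0 + K.+2%:R -> I t by rewrite add0r.
have eps0 : 0 <= ep ^+ K.+2 by exact: exprn_ge0.
suff [C [CC H]] : exists C, C <= (C3 + C4 + C5) * l /\
    `|iter K.+2 (fdiff 1) (line_profile bp bq a be ga0 ga1 ep) 0| <= C * ep ^+ K.+2.
  by apply: le_trans H _; rewrite mulrA ler_wpM2r.
case: bq.
  exists (l * C3); split; first by rewrite mulrC ler_wpM2r// -addrA lerDl addr_ge0.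
  apply: derivs_le_fdiff IT.
  rewrite (_ : line_profile _ _ _ _ _ _ _ =
    fun t => l * (((1 + a)^-1 * P t) * (p t * E1 t))); last first.
    apply/funext => t; rewrite /line_profile -/(P t) -/(p t) /E1 -/l.
    by field; rewrite gt_eqF.
  rewrite -[X in X * C3](ger0_norm l0).
  apply/derivs_leZ/derivs_leM => //; first by nonneg.
  exact: derivs_leM.
have [a1|a1] := leP 1 a.
  exists C4; split.
    have l1 : 1 <= l by rewrite -(powRr0 a); apply: ler_powR => //; exact: ltW.
    apply: (@le_trans _ _ (C4 * l)); first by rewrite ler_peMr.
    rewrite ler_wpM2r//; lra.
  apply: derivs_le_fdiff IT.
  rewrite (_ : line_profile _ _ _ _ _ _ _ =
    fun t => ((1 + a)^-1 * P t) * E1 t); last first.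
    apply/funext => t; rewrite /line_profile -/(P t) -/(p t) /E1 -/l.
    by field; rewrite gt_eqF.
  exact: derivs_leM.
exists (C5 * l); split; first by rewrite ler_wpM2r//; lra.
(* Its values are O(l) because 1 - exp(-u) <= u; its derivatives carry the factor l by the chain
   rule. *)
pose E2 t := expR (- (l * p t)) - 1.
have HE2 : derivs_le K.+2 I E2 (l * (Cp + 2 ^+ K.+1 * (C2 * Cp))) ep.
  have [pB [p' dp Hp']] := Hp; split.
    move=> t It; apply: (@le_trans _ _ (l * Cp)); last first.
      by rewrite ler_wpM2l// lerDl; nonneg.
    have pt := le_trans (ltW c0) (cp _ It).
    rewrite /E2 distrC ger0_norm; last first.
      by rewrite subr_ge0 -expR0 ler_expR oppr_le0 mulr_ge0.
    have := expR_ge1Dx (- (l * p t)).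
    have : l * p t <= l * Cp by rewrite ler_wpM2l//;
      apply: le_trans (ler_norm _) (pB _ It).
    lra.
  exists (fun t => - l * ((l ^+ 0 * 1 * expR (- (l * p t))) * p' t)).
    move=> t It.
    have d1 : is_derive t 1 (fun t => - l * p t) (- l * p' t).
      exact: (@is_deriveZ _ _ _ p (- l) t 1 _ (dp _ It)).
    have d2 := @is_derive1_comp _ expR (fun t => - l * p t) t _ _ (is_derive_expR _) d1.
    have d3 := @is_deriveB _ _ _ _ _ t 1 _ _ d2 (is_derive_cst (1 : R) t 1).
    rewrite (_ : E2 = (expR \o (fun t => - l * p t)) - cst 1); last first.
      by apply/funext => u; rewrite /E2 -mulNr.
    by apply: (is_derive_eq d3); rewrite subr0 expr0 (mulNr l (p t)); ring.
  have := derivs_leZ (- l) (derivs_leM ep0 C20 (mulr_ge0 Cp0 ep0) HE Hp').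
  rewrite normrN (ger0_norm l0); apply: derivs_le_le => //.
  rewrite (_ : l * _ * ep = l * (Cp * ep) + l * (2 ^+ K.+1 * (C2 * (Cp * ep))));
    last by ring.
  by rewrite lerDr; nonneg.
rewrite (_ : line_profile _ _ _ _ _ _ _ = fun t => P t * E2 t + P t); last first.
  apply/funext => t; rewrite /line_profile -/(P t) -/(p t) /E2 -/l.
  by ring.
rewrite iter_fdiffD.
rewrite (_ : iter _ _ P 0 = 0); last first.
  rewrite /P; case: (bp); first exact: fdiff_line_aff.
  rewrite (_ : (fun _ => _) = line_aff 1 1 0 0); first exact: fdiff_line_aff.
  by apply/funext => t; rewrite /line_aff; ring.
rewrite addr0; apply: derivs_le_fdiff IT.
rewrite (_ : C5 * l = 2 ^+ K.+2 * (4 * (l * (Cp + 2 ^+ K.+1 * (C2 * Cp)))));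
  last by rewrite /C5; ring.
apply: derivs_leM => //.
  by nonneg.
by apply: derivs_le_le HP => //; lra.
Qed.

End stable_profile_differences.

(** * Differences of the block factors *)

Section blocks.
Context {R : realType}.
Variables (N M : nat) (b : 'I_N -> 'I_M).
Implicit Types (x y : 'rV[R]_N) (k : 'I_M) (i : 'I_N).

(** The blocks are given by a labelling [b] of the coordinates, so that a function of one block is
    still a function on the whole space and no vector has to be split. *)
Definition bdot k x y : R := \sum_(i | b i == k) x ord0 i * y ord0 i.
Definition bnorm k x : R := Num.sqrt (bdot k x x).

Lemma bdotC k x y : bdot k x y = bdot k y x.
Proof. by apply: eq_bigr => i _; rewrite mulrC. Qed.

Lemma bdotDl k x y z : bdot k (x + y) z = bdot k x z + bdot k y z.
Proof. by rewrite -big_split/=; apply: eq_bigr => i _; rewrite mxE mulrDl. Qed.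

Lemma bdotZl k t x y : bdot k (t *: x) y = t * bdot k x y.
Proof. by rewrite mulr_sumr; apply: eq_bigr => i _; rewrite mxE mulrA. Qed.

Lemma bdotDr k x y z : bdot k x (y + z) = bdot k x y + bdot k x z.
Proof. by rewrite bdotC bdotDl !(bdotC k x). Qed.

Lemma bdotZr k t x y : bdot k x (t *: y) = t * bdot k x y.
Proof. by rewrite bdotC bdotZl bdotC. Qed.

Lemma bdot_ge0 k x : 0 <= bdot k x x.
Proof. by apply: sumr_ge0 => i _; rewrite -expr2 sqr_ge0. Qed.

Lemma bnorm_ge0 k x : 0 <= bnorm k x.
Proof. exact: sqrtr_ge0. Qed.

Lemma bnorm_sqr k x : bnorm k x ^+ 2 = bdot k x x.
Proof. by rewrite sqr_sqrtr// bdot_ge0. Qed.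

Lemma coord_le_bnorm i x : `|x ord0 i| <= bnorm (b i) x.
Proof.
rewrite -sqrtr_sqr ler_wsqrtr// /bdot (bigD1 i)//= expr2 lerDl.
by apply: sumr_ge0 => j _; rewrite -expr2 sqr_ge0.
Qed.

Lemma bdot_le k x y : `|bdot k x y| <= bnorm k x * bnorm k y.
Proof.
have [x0|x0] := eqVneq (bnorm k x) 0.
  rewrite x0 mul0r normr_le0; apply/eqP/big1 => i /eqP ik.
  have := coord_le_bnorm i x; rewrite ik x0 normr_le0 => /eqP ->.
  by rewrite mul0r.
have [y0|y0] := eqVneq (bnorm k y) 0.
  rewrite y0 mulr0 normr_le0; apply/eqP/big1 => i /eqP ik.
  have := coord_le_bnorm i y; rewrite ik y0 normr_le0 => /eqP ->.
  by rewrite mulr0.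
have xp : 0 < bnorm k x by rewrite lt_neqAle eq_sym x0 bnorm_ge0.
have yp : 0 < bnorm k y by rewrite lt_neqAle eq_sym y0 bnorm_ge0.
have xyp := mulr_gt0 xp yp.
(* Expand the squared block norm of |y| x - s |x| y, where s = 1 or s = -1. *)
have key s : s ^+ 2 = 1 -> s * bdot k x y <= bnorm k x * bnorm k y.
  move=> s2.
  have := bdot_ge0 k (bnorm k y *: x - (s * bnorm k x) *: y).
  rewrite -scaleNr bdotDl !bdotDr !bdotZl !bdotZr -!bnorm_sqr (bdotC k y x).
  rewrite (_ : _ + _ = 2 * (bnorm k x * bnorm k y) * (bnorm k x * bnorm k y - s *
    bdot k x y)).
    by rewrite pmulr_rge0 ?mulr_gt0// subr_ge0.
  rewrite (_ : 2 * _ * _ = (1 + s ^+ 2) * bnorm k x ^+ 2 * bnorm k y ^+ 2 - 2 * s *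
    bnorm k x * bnorm k y * bdot k x y).
    by ring.
  by rewrite s2; ring.
rewrite ler_norml; apply/andP; split.
  by rewrite lerNl; have := key (-1); rewrite sqrrN expr1n mulN1r; apply.
by have := key 1; rewrite expr1n mul1r; apply.
Qed.

Lemma bnormD k x y : bnorm k (x + y) <= bnorm k x + bnorm k y.
Proof.
rewrite -(@ler_pXn2r _ 2)// ?nnegrE ?addr_ge0 ?bnorm_ge0//.
rewrite bnorm_sqr bdotDl !bdotDr sqrrD !bnorm_sqr (bdotC k y x).
have : bdot k x y <= bnorm k x * bnorm k y by apply: le_trans (ler_norm _) (bdot_le
  _ _ _).
lra.
Qed.

Lemma bnormZ k t x : bnorm k (t *: x) = `|t| * bnorm k x.
Proof.
by rewrite /bnorm bdotZl bdotZr mulrA -expr2 sqrtrM ?sqr_ge0// sqrtr_sqr.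
Qed.

Lemma bnorm_powR (sigma : R) k x : bnorm k x `^ sigma = (bdot k x x) `^ (sigma / 2).
Proof.
rewrite -bnorm_sqr -powR_mulrn ?bnorm_ge0// -powRrM; congr (_ `^ _).
by field.
Qed.

Lemma bdot_line k x y t : bdot k (x + t *: y) (x + t *: y) =
  bdot k x x + 2 * t * bdot k x y + t ^+ 2 * bdot k y y.
Proof. by rewrite bdotDl !bdotDr !bdotZl !bdotZr (bdotC k y x); ring. Qed.

Section block_profile.
Variable sigma : R.
Hypothesis sigma02 : 0 < sigma < 2.

Let sigma0 : 0 < sigma. Proof. by case/andP: sigma02. Qed.
Let sigma2 : sigma < 2. Proof. by case/andP: sigma02. Qed.

Definition bprofile (bp bq : bool) k i x : R :=
  (if bp then x ord0 i else 1) * (if bq then bnorm k x `^ sigma else 1) *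
  expR (- (bnorm k x `^ sigma)).

(** The value 0 used when [bp] is false keeps both direction cosines at most 1 in absolute value
    even if [i] lies outside block [k]. *)
Lemma bprofile_line (bp bq : bool) k i x h : (bp -> b i = k) ->
  0 < bnorm k x -> 0 < bnorm k h ->
  (fun t => bprofile bp bq k i (x + t *: h)) =
  line_profile sigma bp bq (bnorm k x) (bdot k x h / (bnorm k x * bnorm k h))
    ((if bp then x ord0 i else 0) / bnorm k x)
    ((if bp then h ord0 i else 0) / bnorm k h) (bnorm k h / bnorm k x).
Proof.
move=> bik x0 h0; apply/funext => t.
set be := bdot k x h / _; set ep := bnorm k h / bnorm k x.
have E : bdot k (x + t *: h) (x + t *: h) = bnorm k x ^+ 2 * line_sqr be ep t.
  rewrite bdot_line -!bnorm_sqr /line_sqr /be /ep; field.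
  by rewrite !gt_eqF.
have q0 : 0 <= line_sqr be ep t.
  by rewrite -(pmulr_rge0 _ (exprn_gt0 2 x0)) -E bdot_ge0.
rewrite /bprofile /line_profile.
have -> : bnorm k (x + t *: h) `^ sigma =
    bnorm k x `^ sigma * line_sqr be ep t `^ (sigma / 2).
  by rewrite bnorm_powR E powRM ?sqr_ge0// bnorm_sqr -bnorm_powR.
congr (_ * _ * _); case: bp bik => // _.
rewrite !mxE /line_aff /ep; field.
by rewrite !gt_eqF.
Qed.

(** With l = |x^k|^sigma, this rests on 1 - exp(-l) <= l if [bq] is false and on l exp(-l) <= l if
    [bq] is true. *)
Lemma bprofile_sub_poly (bp bq : bool) k i x : (bp -> b i = k) ->
  `|bprofile bp bq k i x - (if bp then x ord0 i else 1) * (if bq then 0 else 1)|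
    <= (1 + bnorm k x) * bnorm k x `^ sigma.
Proof.
move=> bik; rewrite /bprofile.
set l := bnorm k x `^ sigma; have l0 : 0 <= l by exact: powR_ge0.
have P1 : `|if bp then x ord0 i else 1| <= 1 + bnorm k x.
  case: bp bik => [/(_ isT) <-|_]; last by rewrite normr1 lerDl bnorm_ge0.
  by apply: le_trans (coord_le_bnorm i x) _; rewrite lerDr.
have E1 : expR (- l) <= 1 by rewrite -expR0 ler_expR oppr_le0.
rewrite -!mulrA -mulrBr normrM ler_pM//.
case: bq => /=.
  by rewrite subr0 ger0_norm ?mulr_ge0 ?expR_ge0// ler_piMr.
rewrite mul1r distrC ger0_norm ?subr_ge0//.
have := expR_ge1Dx (- l); lra.
Qed.

Lemma fdiff_poly K (bp bq : bool) i (x h : 'rV[R]_N) :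
  iter K.+2 (fdiff h)
    (fun x : 'rV[R]_N => (if bp then x ord0 i else 1) * (if bq then 0 else 1) : R)
      x = 0.
Proof.
have -> : x = x + 0 *: h by rewrite scale0r addr0.
rewrite iter_fdiff_line.
have [a [c ->]] : exists a c, (fun t : R => (if bp then (x + t *: h) ord0 i else 1)
  * (if bq then 0 else 1) : R)
    = line_aff 1 a c 1; last exact: fdiff_line_aff.
case: bp; case: bq.
- by exists 0, 0; apply/funext => t; rewrite /line_aff; ring.
- by exists (x ord0 i), (h ord0 i); apply/funext => t; rewrite /line_aff !mxE; ring.
- by exists 0, 0; apply/funext => t; rewrite /line_aff; ring.
- by exists 1, 0; apply/funext => t; rewrite /line_aff; ring.
Qed.

(** The bound [S] on the step is there for the coordinate factor: near the origin it has size
    O(|h|), which must stay bounded. *)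
Lemma fdiff_bprofile (L : nat) (S : R) : 0 <= S ->
  exists2 C : R, 0 <= C & forall (bp bq : bool) k i x h,
    (bp -> b i = k) -> 0 < bnorm k h -> bnorm k h <= S ->
    `|iter L.+2 (fdiff h) (bprofile bp bq k i) x| <=
      C * bnorm k h `^ sigma * ((1 + bnorm k x / bnorm k h) ^+ L)^-1.
Proof.
move=> S0.
have [C C0 HC] := fdiff_line_profile sigma02 L.
(* Beyond |x^k| = T |h| the segment of all sample points avoids the origin as [line_sqr_ge]
   requires; below it, all of them have block norm at most U |h|. *)
pose T : R := 2 * L.+2%:R.
pose U : R := T + L.+2%:R.
have T0 : 0 < T by rewrite mulr_gt0// ltr0n.
have U0 : 0 <= U by rewrite addr_ge0// ?ler0n ltW.
pose C1 := 2 ^+ L.+2 * ((1 + U * S) * (1 + U) ^+ 2) * (1 + T) ^+ L.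
have C10 : 0 <= C1.
  by rewrite /C1; have T0' := ltW T0; nonneg.
exists (C * 2 ^+ L + C1); first by nonneg.
move=> bp bq k i x h bik h0 hS.
set s := bnorm k h; set a := bnorm k x.
have s0 : 0 < s by [].
have a0 : 0 <= a by exact: bnorm_ge0.
have y0 : 0 <= a / s by rewrite divr_ge0// ltW.
have y1 : 0 < (1 + a / s) ^+ L by rewrite exprn_gt0// ltr_wpDr.
have [aT|aT] := leP (T * s) a.
  have a1 : 0 < a by apply: lt_le_trans aT; rewrite mulr_gt0.
  have -> : x = x + 0 *: h by rewrite scale0r addr0.
  rewrite iter_fdiff_line (bprofile_line _ bik)//.
  apply: (@le_trans _ _ (C * (a `^ sigma * (s / a) ^+ L.+2))).
    apply: HC => //.
    - by rewrite divr_ge0// ltW.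
    - by rewrite mulrA ler_pdivrMr// mul1r.
    - rewrite normrM normfV (ger0_norm (mulr_ge0 a0 (ltW s0))).
      by rewrite ler_pdivrMr ?mulr_gt0// mul1r bdot_le.
    - rewrite normrM normfV (ger0_norm a0) ler_pdivrMr// mul1r.
      case: bp bik => [/(_ isT) bik|_]; last by rewrite normr0.
      by rewrite /a -bik coord_le_bnorm.
    - rewrite normrM normfV (ger0_norm (ltW s0)) ler_pdivrMr// mul1r.
      case: bp bik => [/(_ isT) bik|_]; last by rewrite normr0 ltW.
      by rewrite /s -bik coord_le_bnorm.
  have yT : 1 <= a / s.
    rewrite ler_pdivlMr// mul1r; apply: le_trans aT; rewrite ler_peMl ?(ltW s0)//.
    by rewrite /T -natrM ler1n.
  apply: (@le_trans _ _ (C * 2 ^+ L * s `^ sigma * ((1 + a / s) ^+ L)^-1)); last first.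
    by rewrite ler_wpM2r ?invr_ge0 ?(ltW y1)// ler_wpM2r ?powR_ge0// lerDl.
  rewrite ler_pdivlMr//.
  set y := a / s in y0 y1 yT *.
  have yp : 0 < y by exact: lt_le_trans yT.
  have aE : a = s * y by rewrite /y; field; rewrite gt_eqF.
  have -> : s / a = y^-1 by rewrite /y invf_div.
  (* As y >= 1 and sigma < 2, y^sigma <= y^2: this costs two of the L + 2 powers of 1 / y. *)
  have ys : a `^ sigma <= s `^ sigma * y ^+ 2.
    rewrite aE powRM ?(ltW s0)// ler_wpM2l ?powR_ge0//.
    by rewrite -powR_mulrn// ler_powR// ltW.
  have yL : (1 + y) ^+ L <= 2 ^+ L * y ^+ L.
    by rewrite -exprMn lerXn2r ?nnegrE //; lra.
  have yK : y^-1 ^+ L.+2 = y^-1 ^+ 2 * y^-1 ^+ L by rewrite -exprD.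
  have yLL : y^-1 ^+ L * y ^+ L = 1 by rewrite -exprMn mulVf ?expr1n// gt_eqF.
  have iy0 : 0 <= y^-1 by rewrite invr_ge0.
  apply: (@le_trans _ _ (C * (s `^ sigma * y ^+ 2 * y^-1 ^+ L.+2) * (2 ^+ L * y ^+ L))).
    apply: ler_pM => //; first by nonneg.
      by rewrite ltW.
    by rewrite ler_wpM2l// ler_wpM2r// exprn_ge0.
  rewrite yK (_ : C * _ * _ = C * 2 ^+ L * s `^ sigma * (y * y^-1) ^+ 2 * (y^-1 ^+
    L * y ^+ L)); last by ring.
  by rewrite yLL mulfV ?gt_eqF// expr1n !mulr1.
(* Near the origin the polynomial is subtracted at no cost. Each sample is then O(s^sigma), and the
   decay factor is harmless because (1 + a / s)^L <= (1 + T)^L. *)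
have -> : bprofile bp bq k i = fun x =>
    (bprofile bp bq k i x - (if bp then x ord0 i else 1) * (if bq then 0 else 1)) +
    (if bp then x ord0 i else 1) * (if bq then 0 else 1).
  by apply/funext => z; rewrite subrK.
rewrite iter_fdiffD fdiff_poly addr0.
have B j : (j <= L.+2)%N -> `|bprofile bp bq k i (x + h *+ j) -
      (if bp then (x + h *+ j) ord0 i else 1) * (if bq then 0 else 1)| <=
    (1 + U * S) * (1 + U) ^+ 2 * s `^ sigma.
  move=> jL; apply: le_trans (bprofile_sub_poly bq (x + h *+ j) bik) _.
  have jU : bnorm k (x + h *+ j) <= U * s.
    apply: le_trans (bnormD _ _ _) _.
    rewrite -scaler_nat bnormZ /U mulrDl lerD ?(ltW aT)// ler_wpM2r// ?(ltW s0)//.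
    by rewrite ger0_norm ?ler0n// ler_nat.
  rewrite -mulrA ler_pM ?powR_ge0 ?addr_ge0 ?bnorm_ge0//.
    rewrite lerD2l; apply: le_trans jU _; exact: ler_wpM2l.
  apply: (@le_trans _ _ ((U * s) `^ sigma)).
    by apply: powR_mono => //; [exact: ltW | exact: bnorm_ge0].
  rewrite powRM ?(ltW s0)// ler_wpM2r ?powR_ge0//.
  exact: powR_le_sqr.
apply: le_trans (iter_fdiff_bound B) _.
apply: (@le_trans _ _ (C1 * s `^ sigma * ((1 + a / s) ^+ L)^-1)); last first.
  rewrite ler_wpM2r ?invr_ge0 ?(ltW y1)// ler_wpM2r ?powR_ge0// lerDr.
  by nonneg.
rewrite ler_pdivlMr// /C1 -[in leRHS]mulrA [in leRHS](mulrC _ (s `^ sigma)) !mulrA.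
rewrite ler_pM//.
- by nonneg.
- exact: ltW.
- rewrite lerXn2r ?nnegrE ?addr_ge0 ?(ltW T0)// lerD2l ler_pdivrMr//.
  exact: ltW.
Qed.


End block_profile.

End blocks.

(** * A one-dimensional majorant *)

Section decay_integral.
Context {R : realType}.
Variables (s ep : R).
Hypotheses (s0 : 0 < s) (ep0 : 0 < ep).

(** Here [s] is a length scale and [ep] the excess over the critical exponent 1. It serves with ep =
    1 in frequency and with ep = sigma / N on the sphere. *)
Definition decay (t : R) : R := (1 + `|t| / s) `^ (- 1 - ep).

Lemma decay_arg_gt0 (t : R) : 0 < 1 + `|t| / s.
Proof. by rewrite ltr_wpDr// divr_ge0// ltW. Qed.

Lemma continuous_decay : continuous decay.
Proof.
move=> t; apply: (@continuous_comp _ _ _ (fun t : R => 1 + `|t| / s) (fun x : R =>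
  x `^ (- 1 - ep))).
  apply: cvgD; first exact: cvg_cst.
  by apply: cvgM; [exact: norm_continuous | exact: cvg_cst].
apply: differentiable_continuous; apply/derivable1_diffP.
by have [] := is_derive1_powR (- 1 - ep) (decay_arg_gt0 t).
Qed.

Lemma measurable_decay : measurable_fun setT decay.
Proof. exact: continuous_measurable_fun continuous_decay. Qed.

Lemma integral_decay :
  (\int[lebesgue_measure]_t (decay t)%:E = (2 * s / ep)%:E)%E.
Proof.
rewrite ge0_symfun_integralT; last 3 first.
- by move=> t; exact: powR_ge0.
- exact: continuous_decay.
- by move=> t; rewrite /decay /= normrN.
rewrite -set_itvcy.
pose F (t : R) := - (s / ep) * (1 + t / s) `^ (- ep).
have dF (t : R) : 0 <= t -> is_derive t 1 F (decay t).
  move=> t0.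
  have p0 : 0 < 1 + t / s by have := decay_arg_gt0 t; rewrite ger0_norm.
  have d1 : is_derive t 1 (fun t => 1 + t / s) s^-1.
    have d := @is_deriveD _ _ _ _ _ t 1 _ _ (is_derive_cst (1 : R) t 1)
      (@is_deriveZ _ _ _ id s^-1 t 1 _ (is_derive_id t 1)).
    rewrite (_ : (fun t => _) = cst 1 + s^-1 \*: id); last first.
      by apply/funext => u; rewrite mulrC.
    by apply: (is_derive_eq d); rewrite add0r; exact: mulr1.
  have d2 := @is_derive1_comp _ (fun x => x `^ (- ep)) _ t _ _ (is_derive1_powR (-
    ep) p0) d1.
  have d3 := @is_deriveZ _ _ _ _ (- (s / ep)) t 1 _ d2.
  apply: (is_derive_eq d3).
  rewrite /decay ger0_norm// (_ : - ep - 1 = - 1 - ep); last by rewrite addrC.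
  rewrite /GRing.scale/=; field.
  by rewrite !gt_eqF.
have Foo : F t @[t --> +oo] --> (0 : R).
  rewrite -(mulr0 (- (s / ep))); apply: cvgM; first exact: cvg_cst.
  apply/cvgr0Pnorm_lt => e e0.
  near=> t.
  have t0 : 0 < t by near: t; apply: nbhs_pinfty_gt; exact: num_real.
  have te : s * e^-1 `^ ep^-1 < t by near: t; apply: nbhs_pinfty_gt; exact: num_real.
  have pt : 0 < 1 + t / s by rewrite addr_gt0// divr_gt0.
  rewrite ger0_norm ?powR_ge0// powRN invf_plt ?posrE ?powR_gt0//.
  rewrite -[ltLHS](_ : (e^-1 `^ ep^-1) `^ ep = e^-1); last first.
    by rewrite -powRrM mulVf ?gt_eqF// powRr1// invr_ge0 ltW.
  apply: (gt0_ltr_powR ep0); rewrite ?nnegrE ?powR_ge0 ?addr_ge0 ?divr_ge0 ?(ltW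
    s0) ?(ltW t0)//.
  by rewrite ltr_wpDl// ltr_pdivlMr// mulrC.
rewrite (@ge0_continuous_FTC2y _ decay F 0 0).
- rewrite /F mul0r addr0 powR1 -EFinB -EFinM; congr EFin; field.
  by rewrite gt_eqF.
- by move=> x _; exact: powR_ge0.
- by apply: continuous_subspaceT; exact: continuous_decay.
- exact: Foo.
- by move=> x x0; have [] := dF x (ltW x0).
- apply: cvg_at_right_filter; apply: differentiable_continuous; apply/derivable1_diffP.
  by have [] := dF 0 (lexx _).
- move=> x; rewrite in_itv/= andbT => x0.
  by rewrite derive1E; have [_ ->] := dF x (ltW x0).
Unshelve. all: by end_near. Qed.

End decay_integral.

(** * Oscillatory integrals *)

Section cosine_integrals.
Context {R : realType}.
Variable N : nat.
Local Notation V := 'rV[R]_N.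
Implicit Types (G f : V -> R) (x h : V) (a : R).

(** The phase [a] covers the real and imaginary parts of a Fourier integral together, and makes
    derivatives in [x] integrals of the same kind. *)
Definition cosint G x a : R :=
  \int[lebesgue_rV N]_xi (cos (dot x xi + a) * G xi).

Lemma dotDr x (y z : V) : dot x (y + z) = dot x y + dot x z.
Proof. by rewrite /dot -big_split/=; apply: eq_bigr => i _; rewrite mxE mulrDr. Qed.

Lemma dotDl x (y z : V) : dot (y + z) x = dot y x + dot z x.
Proof. by rewrite /dot -big_split/=; apply: eq_bigr => i _; rewrite mxE mulrDl. Qed.

Lemma dotZl (t : R) x (y : V) : dot (t *: y) x = t * dot y x.
Proof. by rewrite /dot mulr_sumr; apply: eq_bigr => i _; rewrite mxE mulrA. Qed.

Lemma measurable_dot x : measurable_fun setT (fun xi : V => dot x xi).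
Proof.
apply: measurable_sum => i; apply: measurable_funM; first exact: measurable_cst.
exact: measurable_coord.
Qed.

Lemma measurable_cos_dot x a : measurable_fun setT (fun xi : V => cos (dot x xi + a)).
Proof.
have mc : measurable_fun setT (@cos R) by apply: continuous_measurable_fun;
  exact: continuous_cos.
apply: (measurableT_comp mc); apply: measurable_funD; last exact: measurable_cst.
exact: measurable_dot.
Qed.

Lemma integrable_dominated f (g : V -> R) (c : R) : measurable_fun setT f ->
  (forall xi, `|f xi| <= g xi) -> (\int[lebesgue_rV N]_xi (g xi)%:E <= c%:E)%E ->
  (lebesgue_rV N).-integrable setT (EFin \o f).
Proof.
move=> mf fg gc; apply/integrableP; split; first exact/measurable_EFinP.
apply: (@le_lt_trans _ _ c%:E); last exact: ltry.
apply: le_trans gc; apply: ge0_le_integral_nomeas => xi _; first exact: abse_ge0.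
by rewrite lee_fin.
Qed.

Lemma Rintegral_dominated f (g : V -> R) (c : R) : measurable_fun setT f ->
  (forall xi, `|f xi| <= g xi) -> (\int[lebesgue_rV N]_xi (g xi)%:E <= c%:E)%E ->
  `|\int[lebesgue_rV N]_xi f xi| <= c.
Proof.
move=> mf fg gc; have fi := integrable_dominated mf fg gc.
apply: le_trans (le_normr_Rintegral measurableT fi) _.
rewrite -lee_fin /Rintegral fineK; last first.
  apply: integrable_fin_num => //.
  exact: (integrable_abse fi).
apply: le_trans gc; apply: ge0_le_integral_nomeas => xi _; first by rewrite lee_fin.
by rewrite lee_fin.
Qed.

Lemma integrable_measurable G :
  (lebesgue_rV N).-integrable setT (EFin \o G) -> measurable_fun setT G.
Proof. by move=> /integrableP[/measurable_EFinP]. Qed.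

Lemma integrable_cos G x a :
  (lebesgue_rV N).-integrable setT (EFin \o G) ->
  (lebesgue_rV N).-integrable setT (EFin \o (fun xi => cos (dot x xi + a) * G xi)).
Proof.
move=> iG; apply: (le_integrable measurableT _ _ iG).
  apply/measurable_EFinP; apply: measurable_funM; first exact: measurable_cos_dot.
  exact: integrable_measurable.
move=> xi _; rewrite /= lee_fin normrM -[leRHS]mul1r ler_wpM2r//.
exact: cos_max.
Qed.

Lemma cosint_dominated G (g : V -> R) (c : R) x a : measurable_fun setT G ->
  (forall xi, `|G xi| <= g xi) -> (\int[lebesgue_rV N]_xi (g xi)%:E <= c%:E)%E ->
  `|cosint G x a| <= c.
Proof.
move=> mG Gg gc; apply: (Rintegral_dominated _ _ gc).
  by apply: measurable_funM => //; exact: measurable_cos_dot.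
move=> xi; apply: le_trans (Gg xi).
by rewrite normrM -[leRHS]mul1r ler_wpM2r//; exact: cos_max.
Qed.

Lemma integrable_fdiff h G :
  (lebesgue_rV N).-integrable setT (EFin \o G) ->
  (lebesgue_rV N).-integrable setT (EFin \o fdiff h G).
Proof.
move=> iG; rewrite (_ : _ \o _ = ((EFin \o G) \- (EFin \o (fun x => G (x + h)%R)))%E).
  by apply: integrableB => //; exact: integrable_translate.
by apply/funext.
Qed.

Lemma integrable_iter_fdiff K h G :
  (lebesgue_rV N).-integrable setT (EFin \o G) ->
  (lebesgue_rV N).-integrable setT (EFin \o iter K (fdiff h) G).
Proof. by move=> iG; elim: K => //= K IH; exact: integrable_fdiff. Qed.

(* A translation by [h] with [dot x h = pi] flips the sign of the oscillating factor. *)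
Lemma cosint_fdiff h G x a : dot x h = pi ->
  (lebesgue_rV N).-integrable setT (EFin \o G) ->
  cosint (fdiff h G) x a = 2 * cosint G x a.
Proof.
move=> xh iG; have iGh := integrable_translate h iG.
rewrite /cosint (_ : (fun xi => _) = fun xi =>
    cos (dot x xi + a) * G xi - cos (dot x xi + a) * G (xi + h)); last first.
  by apply/funext => xi; rewrite -mulrBr.
rewrite RintegralB//; [|exact: integrable_cos|exact: (integrable_cos x a iGh)].
have -> : \int[lebesgue_rV N]_xi (cos (dot x xi + a) * G (xi + h)) =
    \int[lebesgue_rV N]_xi (cos (dot x xi + (a - pi)) * G xi).
  rewrite -[RHS](Rintegral_translate h); last exact: integrable_cos.
  by apply: eq_Rintegral => xi _; rewrite dotDr xh addrACA subrr addr0.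
rewrite (_ : (fun xi => cos (dot x xi + (a - pi)) * G xi) =
   fun xi => -1 * (cos (dot x xi + a) * G xi)); last first.
  apply/funext => xi; rewrite mulN1r -mulNr; congr (_ * _).
  by have := cosDpi (dot x xi + (a - pi)); rewrite -addrA subrK => ->; rewrite opprK.
rewrite RintegralZl//; last exact: integrable_cos.
by ring.
Qed.

Lemma cosint_iter_fdiff K h G x a : dot x h = pi ->
  (lebesgue_rV N).-integrable setT (EFin \o G) ->
  cosint (iter K (fdiff h) G) x a = 2 ^+ K * cosint G x a.
Proof.
move=> xh iG; elim: K => [|K IH] /=; first by rewrite expr0 mul1r.
by rewrite cosint_fdiff ?IH// ?exprS ?mulrA//; exact: integrable_iter_fdiff.
Qed.

Lemma iter_fdiff_invariant K h (h' : V) f : (forall x, f (x + h) = f x) ->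
  forall x, iter K (fdiff h') f (x + h) = iter K (fdiff h') f x.
Proof.
by move=> fh; elim: K => //= K IH x; rewrite /fdiff addrAC !IH.
Qed.

Lemma iter_fdiffM K h f G : (forall x, f (x + h) = f x) ->
  forall x, iter K (fdiff h) (fun x => f x * G x) x = f x * iter K (fdiff h) G x.
Proof.
by move=> fh; elim: K => //= K IH x; rewrite /fdiff !IH fh mulrBr.
Qed.

(** A factor invariant under [h k] passes through the differences along [h k], so these fall on the
    k-th factor only. The gain of 2^K per block is discarded: what counts is the decay of the
    differenced factors. *)
Lemma cosint_prod_fdiff M K (g : 'I_M -> V -> R) (h : 'I_M -> V) x a (ks : seq 'I_M) :
  uniq ks -> (forall k, k \in ks -> dot x (h k) = pi) ->
  (forall j k xi, j != k -> g j (xi + h k) = g j xi) ->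
  (lebesgue_rV N).-integrable setT (EFin \o (fun xi => \prod_k g k xi)) ->
  let v k := if k \in ks then iter K (fdiff (h k)) (g k) else g k in
  (lebesgue_rV N).-integrable setT (EFin \o (fun xi => \prod_k v k xi)) /\
  `|cosint (fun xi => \prod_k g k xi) x a| <= `|cosint (fun xi => \prod_k v k xi) x a|.
Proof.
elim: ks => [|k ks IH] /=; first by move=> _ _ _ iG.
move=> /andP[kks uks] xh gh iG.
have xh' j : j \in ks -> dot x (h j) = pi by move=> jks; apply: xh;
  rewrite inE jks orbT.
pose v j := if j \in ks then iter K (fdiff (h j)) (g j) else g j.
have [iv vle] : (lebesgue_rV N).-integrable setT (EFin \o (fun xi => \prod_j v j xi)) /\
    `|cosint (fun xi => \prod_j g j xi) x a| <= `|cosint (fun xi => \prod_j v j xi)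
      x a|.
  exact: IH.
rewrite (_ : (fun xi => \prod_(j < M) _) =
    iter K (fdiff (h k)) (fun xi => \prod_j v j xi)).
  split; first exact: integrable_iter_fdiff.
  apply: le_trans vle _; rewrite cosint_iter_fdiff//; last by apply: xh;
    rewrite inE eqxx.
  by rewrite normrM ler_peMl// ger0_norm ?exprn_ge0// exprn_ege1// ler1n.
pose f xi := \prod_(j | j != k) v j xi.
have fh xi : f (xi + h k) = f xi.
  apply: eq_bigr => j jk; rewrite /v; case: ifP => _; last exact: gh.
  by apply: iter_fdiff_invariant => y; exact: gh.
have -> : (fun xi => \prod_j v j xi) = (fun xi => f xi * g k xi).
  by apply/funext => xi; rewrite (bigD1 k)//= {1}/v (negbTE kks) mulrC.
apply/funext => xi; rewrite iter_fdiffM// (bigD1 k)//= inE eqxx/= mulrC.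
congr (_ * _); apply: eq_bigr => j jk.
by rewrite inE (negbTE jk).
Qed.

End cosine_integrals.

(** * Decay of the transform of a product of block factors *)

Section block_profile_bound.
Context {R : realType}.
Variables (N M : nat) (b : 'I_N -> 'I_M).
Variable sigma : R.
Hypothesis sigma02 : 0 < sigma < 2.
Local Notation V := 'rV[R]_N.

Let sigma0 : 0 < sigma. Proof. by case/andP: sigma02. Qed.

Lemma measurable_bnorm k : measurable_fun setT (@bnorm R N M b k).
Proof.
rewrite (_ : @bnorm R N M b k = (fun a => a `^ 2^-1) \o (fun x => bdot b k x x));
  last first.
  by apply/funext => x; rewrite /= powR12_sqrt//; exact: bdot_ge0.
apply: measurableT_comp; first exact: measurable_powR.
rewrite (_ : (fun x : V => bdot b k x x) = fun x : V => \sum_i (if b i == k then x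
  ord0 i * x ord0 i else 0)).
  apply: measurable_sum => i; case: (b i == k); last exact: measurable_cst.
  by apply: measurable_funM; exact: measurable_coord.
by apply/funext => x; rewrite /bdot big_mkcond.
Qed.

Lemma measurable_bprofile bp bq k i : measurable_fun setT (@bprofile R N M b sigma
  bp bq k i).
Proof.
have mn : measurable_fun setT (fun x => bnorm b k x `^ sigma : R).
  by apply: (measurableT_comp (measurable_powR sigma)); exact: measurable_bnorm.
apply: measurable_funM; last first.
  by apply: measurableT_comp; [exact: measurable_expR | exact: measurable_funN].
apply: measurable_funM.
  by case: bp; [exact: measurable_coord | exact: measurable_cst].
by case: bq => //; exact: measurable_cst.
Qed.

(** This handles the blocks that are left undifferenced, and the integrability of the whole
    product. *)
Lemma bprofile_decay (L : nat) :
  exists2 C : R, 0 <= C & forall (bp bq : bool) k i (x : V), (bp -> b i = k) ->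
    `|bprofile b sigma bp bq k i x| <= C * ((1 + bnorm b k x) ^+ L)^-1.
Proof.
(* One of the three extra powers pays for the coordinate factor, two for r^sigma <= (1 + r)^2. *)
have [D D0 HD] := poly_stretched_exp_bound sigma02 (L + 3) (ltr01 : 0 < 1 :> R).
exists (2 * D); first by rewrite mulr_ge0.
move=> bp bq k i x bik.
set r := bnorm b k x; have r0 : 0 <= r by exact: bnorm_ge0.
have r1 : 1 <= 1 + r by rewrite lerDl.
have rL : 0 < (1 + r) ^+ L by rewrite exprn_gt0// (lt_le_trans ltr01).
rewrite ler_pdivlMr// /bprofile -/r 2!normrM (ger0_norm (expR_ge0 _)).
have P1 : `|if bp then x ord0 i else 1| <= 1 + r.
  case: bp bik => [/(_ isT) bik|_]; last by rewrite normr1.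
  by apply: (@le_trans _ _ r); [rewrite /r -bik coord_le_bnorm | rewrite lerDr].
have Q1 : `|if bq then r `^ sigma else 1| <= 2 * (1 + r) ^+ 2.
  have : 1 <= (1 + r) ^+ 2 by rewrite exprn_ege1.
  case: bq; last by rewrite normr1; lra.
  rewrite ger0_norm ?powR_ge0//; have := powR_le_sqr sigma02 r0; lra.
apply: (@le_trans _ _ (2 * ((1 + r) ^+ (L + 3) * expR (- (1 * r `^ sigma)))));
  last first.
  by rewrite ler_wpM2l// HD.
rewrite exprD mul1r.
rewrite [leRHS](_ : _ = ((1 + r) * (2 * (1 + r) ^+ 2)) * expR (- r `^ sigma) * (1 +
  r) ^+ L); last first.
  by rewrite !exprS expr0; ring.
by rewrite ler_wpM2r ?(ltW rL)// ler_wpM2r ?expR_ge0// ler_pM.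
Qed.

(** A block has at most N coordinates, so the exponent 2N leaves an exponent 2 for each of them; the
    radial weight becomes a product over coordinates. *)
Lemma block_decay_le (k : 'I_M) (s : R) (x : V) : 0 < s ->
  ((1 + bnorm b k x / s) ^+ (2 * N))^-1 <= \prod_(i | b i == k) decay s 1 (x ord0 i).
Proof.
move=> s0.
have y1 (y : R) : 0 <= y -> 1 <= 1 + y / s by move=> y0; rewrite lerDl divr_ge0// ltW.
have E (i : 'I_N) : decay s 1 (x ord0 i) = ((1 + `|x ord0 i| / s) ^+ 2)^-1.
  by rewrite /decay -opprD -(natrD _ 1 1) powR_invn// (le_trans ler01)// y1.
rewrite (eq_bigr _ (fun i _ => E i)) prodfV lef_pV2 ?posrE; last 2 first.
- by rewrite exprn_gt0// (lt_le_trans ltr01)// y1// bnorm_ge0.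
- by apply: prodr_gt0 => i _; rewrite exprn_gt0// (lt_le_trans ltr01)// y1.
apply: (@le_trans _ _ (\prod_(i | b i == k) (1 + bnorm b k x / s) ^+ 2)).
  apply: ler_prod => i /eqP ik; rewrite exprn_ge0 ?(le_trans ler01) ?y1//=.
  rewrite lerXn2r ?nnegrE ?(le_trans ler01) ?y1 ?bnorm_ge0// lerD2l.
  by rewrite ler_wpM2r ?invr_ge0 ?(ltW s0)// -ik coord_le_bnorm.
rewrite prodr_const -exprM ler_weXn2l ?y1 ?bnorm_ge0//.
by rewrite leq_mul2l /= -[leqRHS]card_ord max_card.
Qed.

Definition block_dir (k : 'I_M) (x : V) : V :=
  \row_i (if b i == k then pi * x ord0 i / bnorm b k x ^+ 2 else 0).

Lemma dot_block_dir k x : 0 < bnorm b k x -> dot x (block_dir k x) = pi.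
Proof.
move=> x0.
rewrite (_ : dot _ _ = pi / bnorm b k x ^+ 2 * bdot b k x x).
  by rewrite -bnorm_sqr divfK// expf_neq0// gt_eqF.
rewrite /bdot mulr_sumr [RHS]big_mkcond; apply: eq_bigr => i _; rewrite mxE.
by case: ifP => _; [ring | rewrite mulr0].
Qed.

Lemma bnorm_block_dir k x : 0 < bnorm b k x ->
  bnorm b k (block_dir k x) = pi / bnorm b k x.
Proof.
move=> x0; apply/eqP.
rewrite -(@eqrXn2 _ 2)// ?bnorm_ge0 ?divr_ge0 ?pi_ge0 ?bnorm_ge0//; apply/eqP.
rewrite bnorm_sqr (_ : bdot _ _ _ _ = (pi / bnorm b k x ^+ 2) ^+ 2 * bdot b k x x).
  rewrite -bnorm_sqr; field; exact: lt0r_neq0.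
rewrite /bdot mulr_sumr; apply: eq_bigr => i ik; rewrite !mxE ik; ring.
Qed.

Lemma bprofile_block_dir (bp bq : bool) j k i (x xi : V) : (bp -> b i = j) -> j != k ->
  bprofile b sigma bp bq j i (xi + block_dir k x) = bprofile b sigma bp bq j i xi.
Proof.
move=> bij jk.
have E l : b l = j -> (xi + block_dir k x) ord0 l = xi ord0 l.
  by move=> lj; rewrite !mxE lj (negbTE jk) addr0.
rewrite /bprofile (_ : bnorm b j (xi + _) = bnorm b j xi); last first.
  by congr Num.sqrt; apply: eq_bigr => l /eqP lj; rewrite E.
by congr (_ * _ * _); case: bp bij => // /(_ isT) /E.
Qed.

Lemma integral_block_decay (s : 'I_M -> R) (c : R) : 0 <= c -> (forall k, 0 < s k) ->
  (\int[lebesgue_rV N]_xi (c * \prod_i decay (s (b i)) 1 (xi ord0 i : R))%:E <=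
    (c * \prod_i (2 * s (b i)))%:E)%E.
Proof.
move=> c0 s0.
have m : measurable_fun setT (fun xi : V => \prod_i decay (s (b i)) 1 (xi ord0 i)).
  apply: measurable_prod => i _.
  exact: (measurableT_comp (measurable_decay 1 (s0 (b i))) (measurable_coord i)).
under eq_integral do rewrite EFinM.
rewrite ge0_integralZl//; last 2 first.
- exact/measurable_EFinP.
- by move=> xi _; rewrite lee_fin; apply: prodr_ge0 => i _; exact: powR_ge0.
rewrite EFinM lee_wpmul2l ?lee_fin//.
apply: (@ge0_integral_prod_le R N (fun i => decay (s (b i)) 1)) => [i|i t|i].
- exact: measurable_decay.
- exact: powR_ge0.
- by rewrite integral_decay// divr1.
Qed.

(** Block k contributes the height s_k^sigma, and a factor 2 s_k for each of its coordinates, where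
    s_k is the frequency scale, comparable to 1 / (1 + |x^k|). *)
Lemma cosint_bprofile_bound :
  exists2 C : R, 0 <= C &
  forall (bp bq : 'I_M -> bool) (iota : 'I_M -> 'I_N), (forall k,
    bp k -> b (iota k) = k) ->
    let G xi := \prod_k bprofile b sigma (bp k) (bq k) k (iota k) xi in
    (lebesgue_rV N).-integrable setT (EFin \o G) /\
    forall x a, `|cosint G x a| <=
      C * (\prod_k (1 + bnorm b k x) `^ (- sigma) * \prod_i (1 + bnorm b (b i) x)^-1).
Proof.
have [C1 C10 HC1] := bprofile_decay (2 * N).
have [C2 C20 HC2] := @fdiff_bprofile R N M b sigma sigma02 (2 * N) pi (pi_ge0 R).
pose C0 := C1 + C2; have C00 : 0 <= C0 by exact: addr_ge0.
(* With r = |x^k|: pi / r <= 2 pi / (1 + r) for r >= 1, and 1 <= 2 pi / (1 + r) for r < 1. *)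
pose S : R := 2 * pi.
have S1 : 1 <= S by have := pi_ge2 R; rewrite /S; lra.
have S0 : 0 < S by exact: lt_le_trans S1.
exists ((C0 * S `^ sigma) ^+ M * (2 * S) ^+ N).
  by have S0' := ltW S0; nonneg.
move=> bp bq iota hbp G.
have mprod (u : 'I_M -> V -> R) : (forall k, measurable_fun setT (u k)) ->
    measurable_fun setT (fun xi => \prod_k u k xi).
  by move=> mu; apply: measurable_prod.
have dom (s : 'I_M -> R) (u : 'I_M -> V -> R) : (forall k, 0 < s k) ->
    (forall k xi, `|u k xi| <= C0 * s k `^ sigma * ((1 + bnorm b k xi / s k) ^+ (2
      * N))^-1) ->
    forall xi, `|\prod_k u k xi| <=
      \prod_k (C0 * s k `^ sigma) * \prod_i decay (s (b i)) 1 (xi ord0 i).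
  move=> s0 us xi; rewrite normr_prod (partition_big b xpredT)//= -big_split/=.
  apply: ler_prod => k _; rewrite normr_ge0/=; apply: le_trans (us k xi) _.
  rewrite ler_wpM2l ?mulr_ge0 ?powR_ge0//.
  apply: le_trans (block_decay_le k xi (s0 k)) _.
  by rewrite le_eqVlt; apply/orP; left; apply/eqP/eq_bigr => i /eqP ->.
have mg k : measurable_fun setT (bprofile b sigma (bp k) (bq k) k (iota k)).
  exact: measurable_bprofile.
have s1C (s : R) k xi : s = 1 ->
    `|bprofile b sigma (bp k) (bq k) k (iota k) xi| <=
      C0 * s `^ sigma * ((1 + bnorm b k xi / s) ^+ (2 * N))^-1.
  move=> ->; rewrite powR1 mulr1 divr1; apply: le_trans (HC1 _ _ _ _ _ (hbp k)) _.
  by rewrite ler_wpM2r ?invr_ge0 ?exprn_ge0 ?addr_ge0 ?bnorm_ge0// lerDl.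
have iG : (lebesgue_rV N).-integrable setT (EFin \o G).
  have d := dom (fun=> 1) _ (fun=> ltr01) (fun k xi => s1C 1 k xi erefl).
  apply: (integrable_dominated (mprod _ mg) d).
  apply: (@integral_block_decay (fun=> 1)) => //.
  by apply: prodr_ge0 => k _; rewrite mulr_ge0 ?powR_ge0.
split => // x a.
pose act k := 1 <= bnorm b k x.
(* The length of the difference step in an active block, and the natural scale 1 of the profile in
   the others. *)
pose s k : R := if act k then pi / bnorm b k x else 1.
have s0 k : 0 < s k.
  by rewrite /s; case: ifP => // ak; rewrite divr_gt0 ?pi_gt0// (lt_le_trans ltr01).
have sS k : s k <= S * (1 + bnorm b k x)^-1.
  have r0 := bnorm_ge0 b k x.
  have r1 : 0 < 1 + bnorm b k x by rewrite ltr_wpDr.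
  rewrite ler_pdivlMr// /s /S; case: ifP => [ak|/negbT]; last first.
    by rewrite -ltNge => ak; have := pi_ge2 R; lra.
  have rp : 0 < bnorm b k x by exact: lt_le_trans ak.
  rewrite mulrAC ler_pdivrMr//.
  have -> : 2 * pi * bnorm b k x = pi * (bnorm b k x + bnorm b k x) by ring.
  by rewrite ler_wpM2l ?pi_ge0// lerD2r.
pose ks := [seq k <- enum 'I_M | act k].
have xh k : k \in ks -> dot x (block_dir k x) = pi.
  by rewrite mem_filter => /andP[ak _]; apply: dot_block_dir; exact: lt_le_trans ak.
have gh j k xi : j != k -> bprofile b sigma (bp j) (bq j) j (iota j) (xi +
  block_dir k x) =
    bprofile b sigma (bp j) (bq j) j (iota j) xi.
  by move=> jk; exact: bprofile_block_dir (hbp j) jk.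
have uks : uniq ks by rewrite filter_uniq// enum_uniq.
have := cosint_prod_fdiff (2 * N).+2 a uks xh gh iG.
set v := fun k => if k \in ks then _ else _.
move=> [iv Gv]; apply: le_trans Gv _.
have vk k xi : `|v k xi| <= C0 * s k `^ sigma * ((1 + bnorm b k xi / s k) ^+ (2 *
  N))^-1.
  rewrite /v mem_filter mem_enum andbT; case: ifP => ak; last first.
    by apply: s1C; rewrite /s ak.
  have xp : 0 < bnorm b k x by exact: lt_le_trans ak.
  have E : bnorm b k (block_dir k x) = s k by rewrite /s ak bnorm_block_dir.
  have spi : s k <= pi by rewrite /s ak ler_pdivrMr// ler_peMr// pi_ge0.
  rewrite -E in spi *.
  apply: le_trans (HC2 _ _ _ _ _ _ (hbp k) _ spi) _; first by rewrite E.
  rewrite ler_wpM2r ?invr_ge0 ?exprn_ge0 ?addr_ge0 ?divr_ge0 ?bnorm_ge0//.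
  by rewrite ler_wpM2r ?powR_ge0// lerDr.
have c0 : 0 <= \prod_k (C0 * s k `^ sigma).
  by apply: prodr_ge0 => k _; rewrite mulr_ge0 ?powR_ge0.
apply: le_trans (cosint_dominated _ _ (integrable_measurable iv) (dom s v s0 vk)
  (integral_block_decay c0 s0)) _.
have -> : (C0 * S `^ sigma) ^+ M * (2 * S) ^+ N * 
   (\prod_k (1 + bnorm b k x) `^ (- sigma) * \prod_i (1 + bnorm b (b i) x)^-1) =
   \prod_k (C0 * (S * (1 + bnorm b k x)^-1) `^ sigma) * \prod_i (2 * (S * (1 +
     bnorm b (b i) x)^-1)).
  have cst m (c : R) : c ^+ m = \prod_(i < m) c by rewrite prodr_const card_ord.
  rewrite mulrACA (cst M) (cst N) -!big_split/=.
  congr (_ * _); apply: eq_bigr => k _; last by rewrite mulrA.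
  have r1 : 0 <= 1 + bnorm b k x by rewrite addr_ge0// bnorm_ge0.
  rewrite powRM ?invr_ge0// ?(ltW S0)// mulrA; congr (_ * _).
  by rewrite powRN -[in RHS]powR_inv1// -powRrM mulN1r powRN.
apply: ler_pM => //.
- by apply: prodr_ge0 => i _; rewrite mulr_ge0// ltW.
- apply: ler_prod => k _; rewrite mulr_ge0 ?powR_ge0//= ler_wpM2l//.
  by apply: powR_mono; rewrite ?(ltW sigma0) ?(ltW (s0 k)).
- by apply: ler_prod => i _; rewrite mulr_ge0 ?(ltW (s0 _))//= ler_wpM2l.
Qed.

End block_profile_bound.

(** * Increments of oscillatory integrals in x *)

Section cosint_increments.
Context {R : realType}.
Variable N : nat.
Local Notation V := 'rV[R]_N.
Implicit Types (G : V -> R) (x phi : V) (a : R).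

Lemma cosint_lincomb (I : eqType) (js : seq I) (c : I -> R) (H : I -> V -> R) x a :
  (forall i, (lebesgue_rV N).-integrable setT (EFin \o H i)) ->
  (lebesgue_rV N).-integrable setT (EFin \o (fun xi => \sum_(i <- js) c i * H i xi)) /\
  cosint (fun xi => \sum_(i <- js) c i * H i xi) x a = \sum_(i <- js) c i * cosint
    (H i) x a.
Proof.
move=> iH; elim: js => [|j js [iS ES]].
  split.
    rewrite (_ : _ \o _ = cst 0%E); first exact: integrable0.
    by apply/funext => xi /=; rewrite big_nil.
  rewrite big_nil /cosint (_ : (fun xi => _) = fun=> 0) ?Rintegral_cst ?mul0r//.
  by apply/funext => xi; rewrite big_nil mulr0.
have icH : (lebesgue_rV N).-integrable setT (EFin \o (fun xi => c j * H j xi)).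
  rewrite (_ : _ \o _ = (fun xi => (c j)%:E * (EFin \o H j) xi)%E);
    first exact: integrableZl.
  by apply/funext => xi /=; rewrite EFinM.
have sumE : (fun xi : V => \sum_(i <- j :: js) c i * H i xi) =
    fun xi => c j * H j xi + \sum_(i <- js) c i * H i xi.
  by apply/funext => xi; rewrite big_cons.
rewrite sumE; split.
  rewrite (_ : _ \o _ = ((EFin \o (fun xi => (c j * H j xi)%R)) \+ 
      (EFin \o (fun xi => (\sum_(i <- js) c i * H i xi)%R)))%E); last by apply/funext.
  exact: integrableD.
rewrite big_cons -ES /cosint.
under eq_Rintegral do rewrite mulrDr.
rewrite RintegralD//; [|exact: integrable_cos|exact: integrable_cos].
congr (_ + _); rewrite -RintegralZl//; last exact: integrable_cos.
by apply: eq_Rintegral => xi _; rewrite mulrCA.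
Qed.

(** Differentiation under the integral, dominated by |phi . xi| |G(xi)| for every [u], so the window
    around [t] is arbitrary. The sine that appears is a cosine with phase [a - pi / 2]. *)
Lemma is_derive_cosint G x phi a (t : R) :
  (lebesgue_rV N).-integrable setT (EFin \o G) ->
  (lebesgue_rV N).-integrable setT (EFin \o (fun xi => dot phi xi * G xi)) ->
  is_derive t 1 (fun u => cosint G (x - u *: phi) a)
    (cosint (fun xi => dot phi xi * G xi) (x - t *: phi) (a - pi / 2)).
Proof.
move=> iG iH.
pose f (u : R) (xi : V) := cos (dot (x - u *: phi) xi + a) * G xi.
have df (u : R) xi : is_derive u 1 (f ^~ xi)
    (cos (dot (x - u *: phi) xi + (a - pi / 2)) * (dot phi xi * G xi)).
  have dE (v : R) : dot (x - v *: phi) xi + a = (dot x xi + a) + (- dot phi xi) * v.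
    by rewrite -scaleNr dotDl dotZl; ring.
  have d1 : is_derive u 1 (fun v : R => (dot x xi + a) + (- dot phi xi) * v) (- dot
    phi xi).
    have d := @is_deriveD _ _ _ _ _ u 1 _ _ (is_derive_cst (dot x xi + a) u 1)
      (@is_deriveZ _ _ _ id (- dot phi xi) u 1 _ (is_derive_id u 1)).
    by apply: (is_derive_eq d); rewrite add0r; exact: mulr1.
  have d2 := @is_derive1_comp _ (@cos R) _ u _ _ (is_derive_cos _) d1.
  have d3 := @is_deriveZ _ _ _ _ (G xi) u 1 _ d2.
  rewrite (_ : f ^~ xi = G xi \*: (@cos R \o (fun v => dot x xi + a + - dot phi xi
    * v))); last first.
    by apply/funext => v; rewrite /f dE mulrC.
  apply: (is_derive_eq d3).
  by rewrite addrA cosBpihalf dE -[LHS]/(_ * _); ring.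
have intf u : `](t - 1), (t + 1)[%classic u ->
  (lebesgue_rV N).-integrable setT (EFin \o f u).
  by move=> _; exact: integrable_cos.
have derf u xi : `](t - 1), (t + 1)[%classic u -> setT xi -> derivable (f ^~ xi) u 1.
  by move=> _ _; have [] := df u xi.
have I1 : `](t - 1), (t + 1)[%classic t.
  by rewrite /= in_itv/=; apply/andP; split; lra.
have dfE u xi : partial1of2 f u xi = cos (dot (x - u *: phi) xi + (a - pi / 2)) *
  (dot phi xi * G xi).
  by rewrite partial1of2E; have [_ ->] := df u xi.
have G0 (xi : V) : 0 <= `|dot phi xi * G xi| by [].
have iabs : (lebesgue_rV N).-integrable setT (EFin \o (fun xi : V => `|dot phi xi *
  G xi|)).
  exact: (integrable_abse iH).
have Gub u xi : `](t - 1), (t + 1)[%classic u -> setT xi ->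
    `|partial1of2 f u xi| <= `|dot phi xi * G xi|.
  move=> _ _; rewrite dfE normrM -[leRHS]mul1r ler_wpM2r//.
  exact: cos_max.
have d := @derivable_under_integral R _ _ (lebesgue_rV N) f setT measurableT t (t -
  1) (t + 1)
   I1 intf derf _ G0 iabs Gub.
have e := @differentiation_under_integral R _ _ (lebesgue_rV N) f setT measurableT
  t (t - 1) (t + 1)
   I1 intf derf _ G0 iabs Gub.
apply: DeriveDef; first exact: d.
rewrite -derive1E [LHS]e; apply: eq_Rintegral => xi _.
exact: dfE.
Qed.

(** The mean value point is unknown, so the bound is required on the whole segment; [N] counts the
    terms of phi . xi. *)
Lemma cosint_increment_le G x phi a (s C : R) : 0 <= s ->
  (lebesgue_rV N).-integrable setT (EFin \o G) ->
  (forall i, (lebesgue_rV N).-integrable setT (EFin \o (fun xi : V => xi ord0 i * G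
    xi))) ->
  (forall i, `|phi ord0 i| <= 1) ->
  (forall i t a', 0 <= t <= s ->
    `|cosint (fun xi : V => xi ord0 i * G xi) (x - t *: phi) a'| <= C) ->
  `|cosint G x a - cosint G (x - s *: phi) a| <= s * (N%:R * C).
Proof.
move=> s0 iG iGi phi1 HC.
have HE : (fun xi => dot phi xi * G xi) =
    fun xi => \sum_(i <- enum 'I_N) phi ord0 i * (xi ord0 i * G xi).
  apply/funext => xi; rewrite big_enum /= /dot mulr_suml.
  by apply: eq_bigr => i _; rewrite mulrA.
have iH : (lebesgue_rV N).-integrable setT (EFin \o (fun xi => dot phi xi * G xi)).
  by rewrite HE; case: (cosint_lincomb (enum 'I_N) (fun i => phi ord0 i) x a iGi).
have dF (t : R) := is_derive_cosint x a t iG iH.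
have cF : {within `[0, s], continuous (fun u : R => cosint G (x - u *: phi) a)}.
  by apply: derivable_within_continuous => t _; have [] := dF t.
have [t] := MVT_segment s0 (fun t _ => dF t) cF.
rewrite in_itv/= => ts; rewrite scale0r subr0 distrC => ->.
rewrite subr0 normrM (ger0_norm s0) mulrC ler_wpM2l//.
rewrite HE; case: (cosint_lincomb (enum 'I_N) (fun i => phi ord0 i) (x - t *: phi)
  (a - pi / 2) iGi) => _ ->.
apply: le_trans (ler_norm_sum _ _ _) _.
apply: (@le_trans _ _ (\sum_(i <- enum 'I_N) C)).
  apply: ler_sum => i _; rewrite normrM -[leRHS]mul1r ler_pM//.
  exact: HC.
by rewrite big_enum/= sumr_const card_ord mulr_natl.
Qed.

End cosint_increments.

(** * Integration over the sphere *)

Section sphere_weight.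
Context {R : realType}.
Variables (N M : nat) (b : 'I_N -> 'I_M).
Variable sigma : R.
Hypothesis sigma0 : 0 < sigma.
Local Notation V := 'rV[R]_N.
Implicit Types x phi : V.

(** This is the product over k of (1 + |x^k|)^(- n_k - sigma), the exponent n_k being written as one
    factor per coordinate of block k. *)
Definition block_weight x : R :=
  \prod_k (1 + bnorm b k x) `^ (- sigma) * \prod_i (1 + bnorm b (b i) x)^-1.

Lemma bnorm1_gt0 k x : 0 < 1 + bnorm b k x.
Proof. by rewrite ltr_wpDr// bnorm_ge0. Qed.

Lemma block_weight_ge0 x : 0 <= block_weight x.
Proof.
apply: mulr_ge0; apply: prodr_ge0 => k _; first exact: powR_ge0.
by rewrite invr_ge0 ltW// bnorm1_gt0.
Qed.

Lemma enorm_sqr_bnorm x : enorm x ^+ 2 = \sum_k bnorm b k x ^+ 2.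
Proof.
have d0 : 0 <= dot x x by apply: sumr_ge0 => i _; rewrite -expr2 sqr_ge0.
rewrite /enorm sqr_sqrtr// /dot (partition_big b xpredT)//=.
by apply: eq_bigr => k _; rewrite bnorm_sqr.
Qed.

Lemma bnorm_le_enorm k x : bnorm b k x <= enorm x.
Proof.
rewrite -(@ler_pXn2r _ 2)// ?nnegrE ?bnorm_ge0 ?sqrtr_ge0//.
rewrite enorm_sqr_bnorm (bigD1 k)//= lerDl.
by apply: sumr_ge0 => j _; rewrite sqr_ge0.
Qed.

(** A displacement of length at most 1 divides each 1 + |x^k| by at most 2. This costs 2^sigma per
    block and 2 per coordinate. *)
Lemma block_weight_near x phi (t : R) : enorm phi = 1 -> 0 <= t <= 1 ->
  block_weight (x - t *: phi) <= (2 `^ sigma) ^+ M * 2 ^+ N * block_weight x.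
Proof.
move=> phi1 /andP[t0 t1].
have key k : (1 + bnorm b k x) / 2 <= 1 + bnorm b k (x - t *: phi).
  have : bnorm b k x <= bnorm b k (x - t *: phi) + 1.
    rewrite -{1}(subrK (t *: phi) x); apply: le_trans (bnormD _ _ _ _) _.
    rewrite lerD2l bnormZ ger0_norm// -[leRHS]mul1r ler_pM ?bnorm_ge0//.
    by rewrite -phi1 bnorm_le_enorm.
  have := bnorm_ge0 b k (x - t *: phi); lra.
have kp k : 0 < (1 + bnorm b k x) / 2 by rewrite divr_gt0// bnorm1_gt0.
have cst m (c : R) : c ^+ m = \prod_(i < m) c by rewrite prodr_const card_ord.
rewrite /block_weight mulrACA (cst M) (cst N) -!big_split/=.
apply: ler_pM.
- by apply: prodr_ge0 => k _; exact: powR_ge0.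
- by apply: prodr_ge0 => i _; rewrite invr_ge0 ltW// bnorm1_gt0.
- apply: ler_prod => k _; rewrite powR_ge0/=.
  apply: le_trans (powRN_le (ltW sigma0) (kp k) (key k)) _.
  by rewrite powRM ?invr_ge0 ?(ltW (bnorm1_gt0 _ _))// powRVN// opprK mulrC.
- apply: ler_prod => i _; rewrite invr_ge0 (ltW (bnorm1_gt0 _ _))/=.
  by rewrite -[X in X * _]invrK -invfM lef_pV2 ?posrE ?bnorm1_gt0//
    ?mulr_gt0 ?invr_gt0 ?bnorm1_gt0// mulrC.
Qed.

Lemma measurable_block_weight (r : R) : measurable_fun setT (fun x => block_weight
  (r *: x)).
Proof.
have mr k : measurable_fun setT (fun x : V => 1 + bnorm b k (r *: x)).
  under eq_fun do rewrite bnormZ.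
  apply: measurable_funD; first exact: measurable_cst.
  apply: measurable_funM; first exact: measurable_cst.
  exact: measurable_bnorm.
apply: measurable_funM; apply: measurable_prod => i _.
  exact: (measurableT_comp (measurable_powR _) (mr i)).
rewrite (_ : (fun x => _) = (fun x : V => (1 + bnorm b (b i) (r *: x)) `^ (-1))).
  exact: (measurableT_comp (measurable_powR _) (mr (b i))).
by apply/funext => x; rewrite powR_inv1// ltW// bnorm1_gt0.
Qed.

(** Majorant for one coordinate y_i of a point of the ball when block [k] is the large one: in that
    block the weight is at most M / r and |y_i| <= 1; in the others the excess sigma / N over the
    exponent 1 gives convergence. *)
Definition shell_weight (r : R) (k : 'I_M) (i : 'I_N) (t : R) : R :=
  if b i == k then M%:R / r * \1_(`[(-1)%R, 1%R]%classic) t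
  else decay r^-1 (sigma / N%:R) t.

(* On the sphere some block has norm at least [1 / M]; the other blocks of
   [theta = y / |y|] dominate those of [y], since [|y| <= 1]. *)
Lemma block_weight_sphere (r : R) (y : V) : 1 <= r -> punctured_ball N y ->
  block_weight (r *: normalize y) <=
    \sum_k (M%:R `^ sigma * r `^ (- sigma) * \prod_i shell_weight r k i (y ord0 i)).
Proof.
move=> r1 /andP[y0 y1].
have r0 : 0 < r by exact: lt_le_trans r1.
set th := normalize y.
have thE k : bnorm b k th = (enorm y)^-1 * bnorm b k y.
  by rewrite bnormZ ger0_norm// invr_ge0 ltW.
have yth k : bnorm b k y <= bnorm b k th.
  by rewrite thE ler_peMl ?bnorm_ge0// invf_ge1.
have th1 : \sum_k bnorm b k th ^+ 2 = 1.
  rewrite (eq_bigr (fun k => (enorm y)^-1 ^+ 2 * bnorm b k y ^+ 2)); last first.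
    by move=> k _; rewrite thE exprMn.
  by rewrite -mulr_sumr -enorm_sqr_bnorm -exprMn mulVf ?expr1n// gt_eqF.
have wge0 k i t : 0 <= shell_weight r k i t.
  rewrite /shell_weight; case: ifP => _; last exact: powR_ge0.
  by rewrite mulr_ge0// divr_ge0// ltW.
(* Otherwise every squared block norm would be below 1 / M, and the M squares could not add up to
   1. *)
have [k kM] : exists k, M%:R^-1 <= bnorm b k th.
  apply: contrapT => /forallNP H.
  have M0 : (0 < M)%N.
    rewrite lt0n; apply/negP => /eqP M0; move: th1; rewrite big1 => [/eqP|k].
      by rewrite eq_sym oner_eq0.
    by have := leq_ltn_trans (leq0n k) (ltn_ord k); rewrite {1}M0.
  have M1 : 1 <= M%:R :> R by rewrite ler1n.
  have Mp : 0 < M%:R :> R by rewrite ltr0n.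
  have : \sum_k bnorm b k th ^+ 2 < \sum_(k < M) M%:R^-1.
    apply: ltr_sum; first by apply/hasP; exists (Ordinal M0); rewrite ?mem_index_enum.
    move=> k _; have /negP := H k; rewrite -ltNge => hk.
    have := bnorm_ge0 b k th => h0.
    apply: (@le_lt_trans _ _ (bnorm b k th)) => //.
    rewrite expr2 ler_piMl// (le_trans (ltW hk))// invf_le1//.
  by rewrite th1 sumr_const card_ord -(mulr_natr M%:R^-1) mulVf ?ltxx// gt_eqF.
have Mp : 0 < M%:R :> R by rewrite ltr0n (leq_ltn_trans _ (ltn_ord k)).
(* The large block depends on [y]; summing over all blocks removes this dependence. *)
rewrite (bigD1 k)//=.
apply: (@le_trans _ _ (M%:R `^ sigma * r `^ (- sigma) * \prod_i shell_weight r k i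
  (y ord0 i))); last first.
  rewrite lerDl; apply: sumr_ge0 => j _; rewrite !mulr_ge0 ?powR_ge0//.
  by apply: prodr_ge0.
have rth j : bnorm b j (r *: th) = r * bnorm b j th by rewrite bnormZ gtr0_norm.
have rk : r / M%:R <= 1 + bnorm b k (r *: th).
  by rewrite rth ler_wpDl// ler_wpM2l// ltW.
have rMp : 0 < r / M%:R by rewrite divr_gt0.
rewrite /block_weight (bigD1 k)//= -[leLHS]mulrA; apply: ler_pM.
- exact: powR_ge0.
- rewrite mulr_ge0//; apply: prodr_ge0 => j _; rewrite ?powR_ge0//.
  by rewrite invr_ge0 ltW// bnorm1_gt0.
- apply: le_trans (powRN_le (ltW sigma0) rMp rk) _.
  by rewrite powRM ?invr_ge0 ?(ltW r0) ?(ltW Mp)// powRVN ?(ltW Mp)// opprK mulrC.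
(* The exponent [sigma] of a block [j != k] is shared out among its coordinates. *)
rewrite (partition_big b xpredT)//= [leRHS](partition_big b xpredT)//=.
rewrite [X in _ * X <= _](bigD1 k)//= [leRHS](bigD1 k)//= mulrCA -big_split/=.
apply: ler_pM.
- by apply: prodr_ge0 => i _; rewrite invr_ge0 ltW// bnorm1_gt0.
- apply: prodr_ge0 => j _; rewrite mulr_ge0 ?powR_ge0//; apply: prodr_ge0 => i _.
  by rewrite invr_ge0 ltW// bnorm1_gt0.
- apply: ler_prod => i ik; rewrite invr_ge0 (ltW (bnorm1_gt0 _ _))/= /shell_weight ik.
  rewrite indicE mem_set ?mulr1; last first.
    rewrite /= in_itv/= -ler_norml; apply: le_trans (coord_le_bnorm b i y) _.
    exact: le_trans (bnorm_le_enorm _ _) y1.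
  rewrite (eqP ik) -[leRHS]invrK invf_div lef_pV2 ?posrE ?bnorm1_gt0//.
apply: ler_prod => j jk; apply/andP; split.
  rewrite mulr_ge0 ?powR_ge0//; apply: prodr_ge0 => i _.
  by rewrite invr_ge0 ltW// bnorm1_gt0.
have B1 : 1 <= 1 + bnorm b j (r *: th) by rewrite lerDl bnorm_ge0.
have B0 := bnorm1_gt0 j (r *: th).
apply: (@le_trans _ _ (\prod_(i | b i == j) (1 + bnorm b j (r *: th)) `^ (- 1 -
  sigma / N%:R))).
  rewrite (eq_bigr (fun=> (1 + bnorm b j (r *: th))^-1)); last by move=> i /eqP ->.
  rewrite !prodr_const -[X in _ * X <= _]powR_mulrn ?invr_ge0 ?(ltW B0)//.
  rewrite -[X in _ * X `^ _ <= _]powR_inv1 ?(ltW B0)// -powRrM -powR_mulrn ?powR_ge0//.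
  rewrite -powRrM -powRD; last by rewrite (gt_eqF B0) implybT.
  apply: ler_powR => //; set c : R := #|_|%:R.
  suff : sigma / N%:R * c <= sigma by rewrite mulrBl; lra.
  rewrite -mulrA -[leRHS]mulr1 ler_wpM2l ?(ltW sigma0)// mulrC.
  have [N0|N0] := posnP N; first by rewrite [X in X%:R^-1]N0 invr0 mulr0.
  by rewrite ler_pdivrMr ?ltr0n// mul1r ler_nat -[leqRHS]card_ord max_card.
apply: ler_prod => i /eqP ij; rewrite powR_ge0/= /shell_weight ij (negbTE jk)
  /decay invrK.
rewrite -opprD; apply: powRN_le.
- by rewrite addr_ge0// divr_ge0// ltW.
- by rewrite ltr_wpDr// mulr_ge0// ltW.
- rewrite lerD2l rth mulrC ler_wpM2l ?(ltW r0)// (le_trans _ (yth j))//.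
  by rewrite -ij coord_le_bnorm.
Qed.

(** Each coordinate integral is O(1 / r): it is 2 M / r in block [k] and 2 N / (sigma r) elsewhere.
    The sum of the two constants serves both cases. *)
Lemma integral_shell_weight (r : R) (k : 'I_M) : 1 <= r -> (0 < N)%N ->
  (\int[lebesgue_rV N]_y (\prod_i shell_weight r k i (y ord0 i : R))%:E <=
    (((2 * M%:R + 2 * N%:R / sigma) / r) ^+ N)%:E)%E.
Proof.
move=> r1 N0.
have r0 : 0 < r by exact: lt_le_trans r1.
have rV0 : 0 < r^-1 by rewrite invr_gt0.
have Np : 0 < N%:R :> R by rewrite ltr0n.
have sN : 0 < sigma / N%:R by rewrite divr_gt0.
rewrite (_ : _ ^+ N = \prod_(i < N) ((2 * M%:R + 2 * N%:R / sigma) / r)); last first.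
  by rewrite prodr_const card_ord.
apply: (@ge0_integral_prod_le R N (shell_weight r k)) => [i|i t|i].
- rewrite /shell_weight; case: (b i == k); last exact: measurable_decay.
  by apply: measurable_funM; first exact: measurable_cst.
- rewrite /shell_weight; case: ifP => _; last exact: powR_ge0.
  by rewrite mulr_ge0// divr_ge0// ltW.
- rewrite /shell_weight; case: (b i == k).
    under eq_integral do rewrite EFinM.
    rewrite ge0_integralZl//; last 2 first.
    + by apply/measurable_EFinP; exact: measurable_indic.
    + by rewrite lee_fin divr_ge0// ltW.
    rewrite integral_indic// setIT.
    have E : lebesgue_measure `[(-1)%R, (1 : R)]%classic = 2%:E.
      rewrite lebesgue_measure_itv/= lte_fin ifT; last lra.
      by rewrite -EFinB; congr EFin; lra.
    rewrite [X in (_ * X <= _)%E](_ : _ = 2%:E)//.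
    rewrite -EFinM lee_fin.
    rewrite (_ : M%:R / r * 2 = 2 * M%:R / r); last by ring.
    by rewrite ler_wpM2r ?(ltW rV0)// lerDl divr_ge0 ?mulr_ge0// ltW.
  rewrite integral_decay// lee_fin.
  rewrite (_ : 2 / r / (sigma / N%:R) = 2 * N%:R / sigma / r); last first.
    by field; rewrite !gt_eqF.
  by rewrite ler_wpM2r ?(ltW rV0)// lerDr mulr_ge0.
Qed.

(** Change of variables for the pushforward that defines [sphere_measure]; the integral over the
    sphere is first enlarged to the whole space. *)
Lemma integral_sphere_le (f : V -> \bar R) : measurable_fun setT f ->
  (forall x, (0 <= f x)%E) ->
  (\int[@sphere_measure R N]_(x in sphere N) f x <=
   N%:R%:E * \int[lebesgue_rV N]_(y in @punctured_ball R N) f (normalize y))%E.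
Proof.
move=> mf f0.
have mfn := measurableT_comp mf (@measurable_normalize R N).
pose m1 := mrestr (@lebesgue_rV R N) (@measurable_punctured_ball R N).
apply: (@le_trans _ _ (\int[@sphere_measure R N]_x f x)%E).
  rewrite integral_mkcond; apply: ge0_le_integral_nomeas => x _.
    by apply: erestrict_ge0 => y _; exact: f0.
  by rewrite patchE; case: ifPn.
have -> : (\int[@sphere_measure R N]_x f x =
    \int[mscale (N%:R%:nng)%R m1]_y f (normalize y))%E.
  have := @ge0_integral_pushforward _ _ _ _ R _ (@measurable_normalize R N) 
    (mscale (N%:R%:nng)%R m1) setT f measurableT mf (fun x _ => f0 x).
  rewrite preimage_setT => <-.
  by apply: eq_measure_integral => [|A mA _]; first exact: measurable_normalize.
rewrite ge0_integral_mscale//.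
rewrite lee_wpmul2l// ?lee_fin//.
have mpb := @measurable_punctured_ball R N.
rewrite (@ge0_negligible_integral _ _ _ m1 setT (~` @punctured_ball R N))//;
  last 2 first.
- exact: measurableC.
- by rewrite /m1/= /mrestr setICl measure0.
rewrite setTD setCK le_eqVlt; apply/orP; left; apply/eqP.
apply: eq_measure_integral => A mA Apb.
by rewrite /m1/= /mrestr setIidl.
Qed.

Lemma integral_sphere_block_weight : (0 < N)%N ->
  exists2 C : R, 0 <= C & forall r : R, 1 <= r ->
  (\int[@sphere_measure R N]_(th in sphere N) (block_weight (r *: th))%:E <=
    (C * r `^ (- N%:R - sigma))%:E)%E.
Proof.
move=> N0.
pose E : R := 2 * M%:R + 2 * N%:R / sigma.
(* [N] comes from the surface measure, [M] from the sum over possible large blocks, M^sigma from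
   |theta^k| >= 1 / M, and [E] from each coordinate integral. *)
exists (N%:R * (M%:R * (M%:R `^ sigma * E ^+ N))).
  by rewrite !mulr_ge0 ?powR_ge0// exprn_ge0// /E addr_ge0// !mulr_ge0// invr_ge0 ltW.
move=> r r1; have r0 : 0 < r by exact: lt_le_trans r1.
have mW : measurable_fun setT (fun x : V => (block_weight (r *: x))%:E).
  by apply/measurable_EFinP; exact: measurable_block_weight.
apply: le_trans (integral_sphere_le mW _) _; first by move=> x;
  rewrite lee_fin block_weight_ge0.
rewrite -!mulrA EFinM lee_wpmul2l ?lee_fin//.
pose w k (y : V) := M%:R `^ sigma * r `^ (- sigma) * \prod_i shell_weight r k i (y
  ord0 i).
have sw0 k i t : 0 <= shell_weight r k i t.
  rewrite /shell_weight; case: ifP => _; last exact: powR_ge0.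
  by rewrite mulr_ge0// divr_ge0// ltW.
have p0 k (y : V) : 0 <= \prod_i shell_weight r k i (y ord0 i) by exact: prodr_ge0.
have w0 k y : 0 <= w k y by rewrite /w !mulr_ge0 ?powR_ge0.
have mp k : measurable_fun setT (fun y : V => \prod_i shell_weight r k i (y ord0 i)).
  apply: measurable_prod => i _.
  apply: (measurableT_comp _ (measurable_coord i)).
  rewrite /shell_weight; case: (b i == k); last by apply: measurable_decay;
    rewrite invr_gt0.
  by apply: measurable_funM; first exact: measurable_cst.
have mw k : measurable_fun setT (fun y : V => (w k y)%:E).
  by apply/measurable_EFinP; apply: measurable_funM; [exact: measurable_cst|exact: mp].
apply: (@le_trans _ _ (\int[lebesgue_rV N]_y (\sum_k w k y)%:E)%E).
  rewrite integral_mkcond; apply: ge0_le_integral_nomeas => y _.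
    by apply: erestrict_ge0 => z _; rewrite lee_fin block_weight_ge0.
  rewrite patchE; case: ifPn => [/set_mem yb|_]; rewrite lee_fin.
    exact: block_weight_sphere.
  by apply: sumr_ge0.
under eq_integral do rewrite -sumEFin.
rewrite ge0_integral_sum//; last by move=> k y _; rewrite lee_fin.
apply: (@le_trans _ _ (\sum_(k < M) (M%:R `^ sigma * r `^ (- sigma) * (E / r) ^+
  N)%:E)%E).
  apply: lee_sum => k _; rewrite /w.
  under eq_integral do rewrite EFinM.
  rewrite ge0_integralZl//; last 3 first.
  - by apply/measurable_EFinP; exact: mp.
  - by move=> y _; rewrite lee_fin.
  - by rewrite lee_fin mulr_ge0 ?powR_ge0.
  rewrite [leRHS]EFinM lee_wpmul2l ?lee_fin ?mulr_ge0 ?powR_ge0//.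
  exact: integral_shell_weight.
rewrite sumEFin lee_fin sumr_const card_ord -[X in X <= _]mulr_natl ler_wpM2l//.
rewrite exprMn powRD; last by rewrite (gt_eqF r0) implybT.
rewrite (powR_invn _ (ltW r0)) exprVn.
by rewrite le_eqVlt; apply/orP; left; apply/eqP; ring.
Qed.

End sphere_weight.

(** * The operator applied to the profile *)

Section anisotropic_profile.
Context {R : realType} (M : nat) (n : 'I_M -> nat) (sigma : R).
Local Notation N := (\sum_(k < M) n k)%N.
Local Notation V := 'rV[R]_N.
Local Notation blk := (@tagnat.sig1 M n).

(** Matches the row-block decomposition in the definition of the symbol with the labelling of
    coordinates used in the estimates: coordinates are reindexed by pairs (block, position), and the
    pairs of block [k] are kept. *)
Lemma enorm_submxrow (x : V) k : enorm (submxrow x k) = bnorm blk k x.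
Proof.
rewrite /enorm /bnorm; congr Num.sqrt; rewrite /bdot /dot.
rewrite [RHS](reindex _ (onW_bij _ tagnat.rank_bij)) /=.
rewrite (eq_bigl (fun p : {i & 'I_(n i)} => (tag p == k) && true)); last first.
  by move=> p; rewrite andbT tagnat.rankE tagnat.Rank1K.
rewrite (eq_bigr (fun p : {i & 'I_(n i)} =>
  x ord0 (tagnat.Rank _ (tagged p)) * x ord0 (tagnat.Rank _ (tagged p)))); last first.
  by move=> p _; rewrite tagnat.rankE.
rewrite -(sig_big_dep (fun i => i == k) (fun _ _ => true)
  (fun i (j : 'I_(n i)) => x ord0 (tagnat.Rank _ j) * x ord0 (tagnat.Rank _ j))) /=.
rewrite big_pred1_eq; apply: eq_bigr => j _.
by rewrite !mxE.
Qed.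

Definition symbol_term (l : 'I_M) (xi : V) : R :=
  partial_symbol sigma l xi * expR (- symbol sigma xi).

Lemma symbol_termE (l : 'I_M) i :
  symbol_term l = fun xi => \prod_k bprofile blk sigma false (k == l) k i xi.
Proof.
apply/funext => xi; rewrite /symbol_term /symbol /partial_symbol.
under [X in - X]eq_bigr do rewrite enorm_submxrow.
rewrite enorm_submxrow -sumrN expR_sum [X in _ * X = _](bigD1 l)//= mulrA.
rewrite [RHS](bigD1 l)//= /bprofile eqxx mul1r; congr (_ * _).
by apply: eq_bigr => k /negbTE ->; rewrite !mul1r.
Qed.

(** The factor xi_i is absorbed by the block that contains [i], so the bound for products of block
    factors also controls gradients. *)
Lemma coord_symbol_termE (l : 'I_M) i :
  (fun xi : V => xi ord0 i * symbol_term l xi) =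
  fun xi => \prod_k bprofile blk sigma (k == blk i) (k == l) k i xi.
Proof.
apply/funext => xi; rewrite (symbol_termE l i) [X in _ * X = _](bigD1 (blk i))//= mulrA.
rewrite [RHS](bigD1 (blk i))//= /bprofile eqxx !mul1r !mulrA; congr (_ * _).
by apply: eq_bigr => k /negbTE ->.
Qed.

(** Phase 0 gives the real part and phase pi / 2 the imaginary part, as cos(u + pi / 2) = - sin u.
    Both are estimated in the same way, without using that the imaginary part vanishes. *)
Definition laplacian_part (a : R) (x : V) : R :=
  (2 * pi) ^- N * \sum_l cosint (symbol_term l) x a.

Lemma sum_Complex (f g : 'I_M -> R) :
  \sum_l Complex (f l) (g l) = Complex (\sum_l f l) (\sum_l g l).
Proof. by elim/big_rec3: _ => // l z y x _ ->. Qed.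

Lemma aniso_laplacian_profile (Phi : V -> R) x : is_profile sigma Phi ->
  aniso_laplacian sigma (fun x => (Phi x)%:C%C) x =
  Complex (laplacian_part 0 x) (laplacian_part (pi / 2) x).
Proof.
move=> hPhi; rewrite /aniso_laplacian /laplacian_part !mulr_sumr -sum_Complex.
apply: eq_bigr => l _.
rewrite /partial_frac_laplacian /fourier_multiplier /inv_fourier.
rewrite (_ : cintegral _ = Complex (cosint (symbol_term l) x 0) (cosint
  (symbol_term l) x (pi / 2))).
  by apply/eqP; rewrite eq_complex /=; apply/andP; split; apply/eqP; ring.
have E xi : cexpi (- dot x xi) * ((partial_symbol sigma l xi)%:C%C *
     fourier (fun x => (Phi x)%:C%C) xi) =
    Complex (cos (dot x xi + 0) * symbol_term l xi) (cos (dot x xi + pi / 2) *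
      symbol_term l xi).
  rewrite (profile_fourier hPhi) /cexpi cosN sinN cosDpihalf addr0 /symbol_term.
  by apply/eqP; rewrite eq_complex /=; apply/andP; split; apply/eqP; ring.
by rewrite /cintegral; congr Complex; apply: eq_Rintegral => xi _; rewrite E.
Qed.

Lemma normc_le (u v : R) : normc (Complex u v) <= `|u| + `|v|.
Proof.
rewrite /normc -(@ler_pXn2r _ 2)// ?nnegrE ?addr_ge0 ?sqrtr_ge0//.
rewrite sqr_sqrtr ?addr_ge0 ?sqr_ge0// sqrrD !real_normK ?num_real//.
by rewrite addrAC lerDl mulrn_wge0// mulr_ge0.
Qed.

Hypothesis sigma02 : 0 < sigma < 2.
Hypothesis N0 : (0 < N)%N.

Let sigma0 : 0 < sigma. Proof. by case/andP: sigma02. Qed.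

Lemma laplacian_part_bounds : exists2 C : R, 0 <= C &
  (forall a x, `|laplacian_part a x| <= C * block_weight blk sigma x) /\
  (forall a x phi (s : R), 0 <= s <= 1 -> enorm phi = 1 ->
    `|laplacian_part a x - laplacian_part a (x - s *: phi)| <=
      C * s * block_weight blk sigma x).
Proof.
have [C C0 HC] := @cosint_bprofile_bound R N M blk sigma sigma02.
have [D D0 HD] : exists2 D : R, 0 <= D & forall x phi (t : R),
  enorm phi = 1 -> 0 <= t <= 1 ->
    block_weight blk sigma (x - t *: phi) <= D * block_weight blk sigma x.
  exists ((2 `^ sigma) ^+ M * 2 ^+ N); first by nonneg.
  by move=> x phi t phi1 t01; exact: block_weight_near.
pose c : R := (2 * pi) ^- N.
have c0 : 0 <= c by rewrite invr_ge0 exprn_ge0// mulr_ge0// pi_ge0.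
have i0 : 'I_N := Ordinal N0.
have W0 x := block_weight_ge0 blk sigma x.
have b1 (k : 'I_M) : false -> blk i0 = k by [].
have iG l : (lebesgue_rV N).-integrable setT (EFin \o symbol_term l).
  rewrite (symbol_termE l i0).
  by case: (HC (fun=> false) (fun k => k == l) (fun=> i0) b1).
have Gle l x a : `|cosint (symbol_term l) x a| <= C * block_weight blk sigma x.
  rewrite (symbol_termE l i0).
  by case: (HC (fun=> false) (fun k => k == l) (fun=> i0) b1) => _; apply.
have b2 i : forall k : 'I_M, k == blk i -> blk i = k by move=> k /eqP.
have iGi l i : (lebesgue_rV N).-integrable setT (EFin \o (fun xi : V => xi ord0 i *
  symbol_term l xi)).
  rewrite (coord_symbol_termE l i).
  by case: (HC (fun k => k == blk i) (fun k => k == l) (fun=> i) (b2 i)).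
have Gile l i x a : `|cosint (fun xi : V => xi ord0 i * symbol_term l xi) x a| <= C
  * block_weight blk sigma x.
  rewrite (coord_symbol_termE l i).
  by case: (HC (fun k => k == blk i) (fun k => k == l) (fun=> i) (b2 i)) => _; apply.
exists (c * (M%:R * C) + c * (M%:R * (N%:R * (C * D)))).
  by nonneg.
split.
  move=> a x; apply: (@le_trans _ _ (c * (M%:R * C) * block_weight blk sigma x));
    last first.
    by rewrite ler_wpM2r// lerDl; nonneg.
  rewrite /laplacian_part normrM (ger0_norm c0) -!mulrA ler_wpM2l//.
  apply: le_trans (ler_norm_sum _ _ _) _.
  apply: (@le_trans _ _ (\sum_(l < M) C * block_weight blk sigma x)).
    by apply: ler_sum => l _; exact: Gle.
  by rewrite sumr_const card_ord -[X in X <= _]mulr_natl.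
move=> a x phi s /andP[s0 s1] phi1.
apply: (@le_trans _ _ (c * (M%:R * (N%:R * (C * D))) * s * block_weight blk sigma
  x)); last first.
  by rewrite ler_wpM2r// ler_wpM2r// lerDr; nonneg.
rewrite /laplacian_part -mulrBr -sumrB normrM (ger0_norm c0) -!mulrA ler_wpM2l//.
apply: le_trans (ler_norm_sum _ _ _) _.
apply: (@le_trans _ _ (\sum_(l < M) s * (N%:R * (C * (D * block_weight blk sigma x))))).
  apply: ler_sum => l _; apply: cosint_increment_le => //.
    move=> i; rewrite -phi1; apply: le_trans (coord_le_bnorm blk i phi) _.
    exact: bnorm_le_enorm.
  move=> i t a' /andP[t0 ts]; apply: le_trans (Gile _ _ _ _) _.
  by rewrite ler_wpM2l// HD// t0 (le_trans ts).
rewrite sumr_const card_ord -[X in X <= _]mulr_natl.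
by rewrite le_eqVlt; apply/orP; left; apply/eqP; ring.
Qed.

Lemma measurable_sphere : measurable (@sphere R N).
Proof.
rewrite (_ : sphere N = setT `&` @enorm R N @^-1` [set 1]); last first.
  by rewrite setTI.
exact: measurable_enorm.
Qed.

(** Comparison through [ge0_le_integral_nomeas] spares a proof that [f], which will be the modulus
    of L Phi or of its increment, is measurable. *)
Lemma integral_sphere_le_block_weight : exists2 C : R, 0 <= C &
  forall (r e : R) (f : V -> R), 1 <= r -> 0 <= e -> (forall x, 0 <= f x) ->
    (forall th, f th <= e * block_weight blk sigma (r *: th)) ->
  (\int[sphere_measure N]_(th in sphere N) (f th)%:E <=
    (C * e * r `^ (- N%:R - sigma))%:E)%E.
Proof.
have [C C0 HC] := @integral_sphere_block_weight R N M blk sigma sigma0 N0.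
exists C => // r e f r1 e0 f0 fe.
apply: (@le_trans _ _ (\int[sphere_measure N]_(th in sphere N)
    (e%:E * (block_weight blk sigma (r *: th))%:E))%E).
  apply: ge0_le_integral_nomeas => th _; first by rewrite lee_fin.
  by rewrite -EFinM lee_fin.
rewrite ge0_integralZl//; last 3 first.
- exact: measurable_sphere.
- apply: measurable_funTS; apply/measurable_EFinP.
  exact: measurable_block_weight.
- by move=> th _; rewrite lee_fin block_weight_ge0.
rewrite (mulrC C) -mulrA EFinM lee_wpmul2l ?lee_fin//.
exact: HC.
Qed.

End anisotropic_profile.

Theorem theorem1p3 (R : realType) (N M : nat) (n : 'I_M -> nat) (sigma : R)
    (hM : (1 <= M <= N)%N) (hn : forall k, (1 <= n k)%N)
    (hN : (\sum_(k < M) n k)%N = N)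
    (hsigma : 0 < sigma < 2)
    (Phi : 'rV[R]_(\sum_(k < M) n k) -> R) (hPhi : is_profile sigma Phi) :
  let LPhi := aniso_laplacian sigma (fun x => (Phi x)%:C%C) in
  exists c : R, [/\ 0 < c,
    (forall r : R, 1 <= r ->
      (\int[sphere_measure _]_(theta in sphere _) (normc (LPhi (r *: theta)))%:E
        <= (c * r `^ (- N%:R - sigma))%:E)%E) &
    (forall (r s delta : R) (phi : 'rV[R]_(\sum_(k < M) n k)),
      0 < s -> s < delta -> delta <= 1 -> sphere _ phi -> 1 <= r ->
      (\int[sphere_measure _]_(theta in sphere _)
          (normc (LPhi (r *: theta) - LPhi (r *: theta - s *: phi)))%:E
        <= (c * delta * r `^ (- N%:R - sigma))%:E)%E)].
Proof.
move=> LPhi; case/andP: hM => M0 MN.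
have N0 : (0 < \sum_(k < M) n k)%N by rewrite hN (leq_trans M0).
rewrite -hN.
have [C C0 [Cle Cinc]] := laplacian_part_bounds hsigma N0.
have [D D0 HD] := integral_sphere_le_block_weight hsigma N0.
have normc_ge0 (z : R[i]) : 0 <= normc z by case: z => u v; exact: sqrtr_ge0.
(* The 2 accounts for the real and imaginary parts, the 1 makes the constant positive. *)
exists (D * (2 * C) + 1); split; first by rewrite ltr_wpDl// !mulr_ge0.
- move=> r r1.
  apply: (@le_trans _ _ (D * (2 * C) * r `^ (- (\sum_(k < M) n k)%:R - sigma))%:E).
    apply: HD => //; first by rewrite mulr_ge0.
    move=> th; rewrite /LPhi (aniso_laplacian_profile _ hPhi).
    apply: le_trans (normc_le _ _) _.
    by rewrite (_ : 2 * C * _ = C * block_weight (@tagnat.sig1 M n) sigma (r *: th) +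
      C * block_weight (@tagnat.sig1 M n) sigma (r *: th)) ?lerD//; ring.
  by rewrite lee_fin ler_wpM2r ?powR_ge0// lerDl.
move=> r s delta phi s0 sd d1 phi1 r1.
have d0 : 0 < delta by exact: lt_trans sd.
apply: (@le_trans _ _ (D * (2 * C * s) * r `^ (- (\sum_(k < M) n k)%:R - sigma))%:E).
  apply: HD => //; first by rewrite !mulr_ge0// ltW.
  move=> th; rewrite /LPhi !(aniso_laplacian_profile _ hPhi).
  apply: le_trans (normc_le _ _) _.
  rewrite (_ : 2 * C * _ * _ = C * s * block_weight (@tagnat.sig1 M n) sigma (r *: th) +
    C * s * block_weight (@tagnat.sig1 M n) sigma (r *: th)); last by ring.
  have s01 : 0 <= s <= 1 by rewrite (ltW s0) ltW// (lt_le_trans sd).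
  by apply: lerD; exact: Cinc.
rewrite lee_fin ler_wpM2r ?powR_ge0// mulrA.
apply: (@le_trans _ _ (D * (2 * C) * delta)).
  by rewrite ler_wpM2l ?mulr_ge0// ltW.
by rewrite ler_wpM2r ?lerDl// ltW.
Qed.
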